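(* Let $H$ be a numerical semigroup with $\operatorname{embdim}(H)=4$ which is symmetric and not a complete intersection. The following are equivalent: (a) $H$ is Koszul; (b) $H$ is quadratic; (c) $e(H)=5$; (d) $H=\langle 5,4a+b,2a+3b,3a+2b\rangle$ for some positive integers $a,b$ such that $a-b$ is not divisible by $5$. Moreover, the integers $a$ and $b$ in (d) are uniquely determined by $H$.
   Context: A numerical semigroup is a submonoid $H\subseteq\mathbb{N}$ with finite complement; $G(H)$ is its minimal generating set, $e(H)=\min G(H)$, $\operatorname{embdim}(H)=|G(H)|$. The Frobenius number is $g(H)=\max(\mathbb{N}\setminus H)$; $H$ is symmetric if for every integer $m$ exactly one of $m$ and $g(H)-m$ lies in $H$. $K$ is a field, $K[H]=\bigoplus_{h\in H}Kt^h$ with maximal ideal $\mathfrak m$; with $G(H)=\{a_1,\dots,a_n\}$, $I_H=\ker(K[x_1,\dots,x_n]\to K[H],\ x_i\mapsto t^{a_i})$; $H$ is a complete intersection if $I_H$ is minimally generated by $\operatorname{height}I_H$ elements. $f^*$ is the lowest-degree homogeneous component of $f\neq 0$, $I_H^*=(f^*:0\neq f\in I_H)$, $\operatorname{gr}_{\mathfrak m}K[H]\cong K[x_1,\dots,x_n]/I_H^*$. $H$ is quadratic if $I_H^*$ is generated in degree 2 and Koszul if $\operatorname{gr}_{\mathfrak m}K[H]$ is a Koszul algebra (its residue field has a linear free resolution over it). *)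

(* Defs.v *)
From HB Require Import structures.
From mathcomp Require Import all_boot all_order all_algebra.
From mathcomp Require Import mpoly.

Set Implicit Arguments.
Unset Strict Implicit.
Unset Printing Implicit Defensive.

Import GRing.Theory.

Definition numerical_semigroup (H : nat -> Prop) : Prop :=
  [/\ H 0%N,
      (forall x y, H x -> H y -> H (x + y)%N)
    & exists N, forall m, (N <= m)%N -> H m].

Inductive in_gen (S : nat -> Prop) : nat -> Prop :=
| in_gen0 : in_gen S 0
| in_genS x m : S x -> in_gen S m -> in_gen S (x + m).

(* {a_0, ..., a_{k-1}} (pairwise distinct) is the minimal generating set
   G(H) of H: it generates H and no proper subset generates H.
   In particular embdim(H) = k. *)
Definition min_gen_set (H : nat -> Prop) (k : nat) (a : 'I_k -> nat) : Prop :=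
  [/\ injective a,
      (forall m, H m <-> in_gen (fun y => exists i, a i = y) m)
    & forall i, ~ (forall m, H m <-> in_gen (fun y => exists2 j, j != i & a j = y) m)].

Definition multiplicity_is (k : nat) (a : 'I_k -> nat) (e : nat) : Prop :=
  (exists i, a i = e) /\ (forall i, (e <= a i)%N).

Definition inH (H : nat -> Prop) (m : int) : Prop :=
  match m with Posz k => H k | Negz _ => False end.

Definition frobenius (H : nat -> Prop) (g : nat) : Prop :=
  ~ H g /\ forall m, (g < m)%N -> H m.

Definition symmetric_sg (H : nat -> Prop) : Prop :=
  exists g, frobenius H g /\
    forall m : int, ~ (inH H m <-> inH H ((Posz g) - m)%R).

Section PolyDefs.
Variables (K : fieldType) (n : nat).
Local Open Scope ring_scope.

Definition evalH (a : 'I_n -> nat) (p : {mpoly K[n]}) : {poly K} :=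
  mmap (@polyC K) (fun i => 'X^(a i)) p.

Definition IH (a : 'I_n -> nat) (p : {mpoly K[n]}) : Prop := evalH a p = 0.

Definition in_ideal (S : {mpoly K[n]} -> Prop) (p : {mpoly K[n]}) : Prop :=
  exists k (g c : 'I_k -> {mpoly K[n]}),
    (forall i, S (g i)) /\ p = \sum_(i < k) c i * g i.

Definition hcomp (d : nat) (p : {mpoly K[n]}) : {mpoly K[n]} :=
  \sum_(m <- msupp p | mdeg m == d) p@_m *: 'X_[m].

Definition homogeneous (d : nat) (p : {mpoly K[n]}) : bool :=
  all (fun m => mdeg m == d) (msupp p).

Definition initial_form (f g : {mpoly K[n]}) : Prop :=
  exists d, [/\ g = hcomp d f, g != 0 & forall d', (d' < d)%N -> hcomp d' f = 0].

Definition IHstar (a : 'I_n -> nat) (p : {mpoly K[n]}) : Prop :=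
  in_ideal (fun g => exists f, IH a f /\ f != 0 /\ initial_form f g) p.

Definition quadratic (a : 'I_n -> nat) : Prop :=
  forall p, IHstar a p -> in_ideal (fun q => IHstar a q /\ homogeneous 2 q) p.

(* gr_m K[H] = K[x]/I_H^* is Koszul : the residue field K has a linear
   graded free resolution over A = K[x]/J (J = I_H^* ):
     ... -> A^{b 2} --M 1--> A^{b 1} --M 0--> A^{b 0} --d0--> A --> K -> 0
   all maps given by matrices of linear forms (acting on row vectors),
   exactness checked modulo J. *)
Definition koszul_ideal (J : {mpoly K[n]} -> Prop) : Prop :=
  exists (b : nat -> nat) (d0 : 'cV[{mpoly K[n]}]_(b 0%N))
         (M : forall i : nat, 'M[{mpoly K[n]}]_(b i.+1, b i)),
  [/\ (forall j, homogeneous 1 (d0 j 0)),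
      (forall i j k, homogeneous 1 (M i j k)),
      (* exactness at A : image of d0 = kernel of A -> K *)
      (forall p, p@_0%MM = 0 <-> exists w : 'rV_(b 0%N), J (p - (w *m d0) 0 0)),
      (forall v : 'rV_(b 0%N), J ((v *m d0) 0 0) <->
          exists w : 'rV_(b 1%N), forall j, J ((v - w *m M 0%N) 0 j))
    &
      (forall i (v : 'rV_(b i.+1)), (forall j, J ((v *m M i) 0 j)) <->
          exists w : 'rV_(b i.+2), forall j, J ((v - w *m M i.+1) 0 j))].

Definition koszul (a : 'I_n -> nat) : Prop := koszul_ideal (IHstar a).

Definition is_ideal (I : {mpoly K[n]} -> Prop) : Prop :=
  [/\ I 0, (forall p q, I p -> I q -> I (p + q)) & (forall r p, I p -> I (r * p))].

Definition prime_ideal (I : {mpoly K[n]} -> Prop) : Prop :=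
  [/\ is_ideal I, ~ I 1 & forall p q, I (p * q) -> I p \/ I q].

Definition prime_chain_to (I : {mpoly K[n]} -> Prop) (h : nat) : Prop :=
  exists c : nat -> {mpoly K[n]} -> Prop,
  [/\ (forall i, (i <= h)%N -> prime_ideal (c i)),
      (forall i, (i < h)%N ->
         (forall p, c i p -> c i.+1 p) /\ exists p, c i.+1 p /\ ~ c i p)
    & (forall p, c h p <-> I p)].

Definition height_is (I : {mpoly K[n]} -> Prop) (h : nat) : Prop :=
  prime_chain_to I h /\ forall k, prime_chain_to I k -> (k <= h)%N.

Definition generated_by_k (I : {mpoly K[n]} -> Prop) (k : nat) : Prop :=
  exists g : 'I_k -> {mpoly K[n]},
    forall p, I p <-> in_ideal (fun q => exists i, q = g i) p.

Definition num_min_gens (I : {mpoly K[n]} -> Prop) (m : nat) : Prop :=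
  generated_by_k I m /\ forall k, generated_by_k I k -> (m <= k)%N.

Definition complete_intersection (a : 'I_n -> nat) : Prop :=
  exists h, height_is (IH a) h /\ num_min_gens (IH a) h.

End PolyDefs.

Definition form_d (H : nat -> Prop) (x y : nat) : Prop :=
  [/\ (0 < x)%N, (0 < y)%N, x %% 5 != y %% 5
    & forall m, H m <-> in_gen (fun z => [\/ z = 5, z = 4 * x + y,
                                             z = 2 * x + 3 * y | z = 3 * x + 2 * y]) m].

(* Main.v *)
(* The ideal I_H is spanned by binomials, and I_H^* by initial forms, so both are
   governed by the factorizations of the elements of H.

   Koszul => quadratic: d0 consists of linear forms spanning the variables, and a
   form of degree d > 2 in I_H^* is v.d0 with v a syzygy; linearity of the first
   syzygies writes it through quadrics and forms of smaller degree.

   Quadratic => e(H) = 5: for a generator a_i > e(H) the power x_i^(e(H)) lies in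
   I_H^*, so x_i^2 must occur in a quadric of I_H^* and 2 a_i has a second
   factorization.  Hence every element of the Apery set of e(H) is a subset sum of
   the three other generators p < q < r.  The Apery set being symmetric, its
   maximum is p + r = 2q, and then it has five elements, or p + q + r, and then
   I_H is generated by three binomials x_i^2 - m_i.  As I_H has height 3, H is a
   complete intersection in the latter case.

   e(H) = 5 => (d) and Koszul: the Apery set is {0, p, q, r, 2q} with 2q = p + r,
   from which a and b are read off.  The tangent cone is Cohen-Macaulay and
   (0), (t), (t,x), (t,x,y), (t,x,y,z) is a Koszul filtration of it; the leading
   coefficients of the syzygies again form members of this flag, so that the
   linear resolution can be continued step by step. *)
From HB Require Import structures.
Require Import Defs.
From mathcomp Require Import all_boot all_order all_algebra.
From mathcomp Require Import ssrcomplements mpoly.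
From mathcomp Require Import zify.
From Stdlib Require Import Classical ClassicalEpsilon.

Set Implicit Arguments.
Unset Strict Implicit.
Unset Printing Implicit Defensive.

Import GRing.Theory.
Local Open Scope ring_scope.

(** * Initial forms *)

(** Membership in I_H and in I_H^* is tested on sums of coefficients over monomials of equal weight;
    for I_H^* only the longest factorizations count. Height is defined by chains of primes, so
    height 3 needs an explicit chain, found by sending the variables one after another to powers of
    x_0, and a bound on all chains, found by counting monomials in algebraically independent
    elements. That three generators are necessary shows in the coefficients of the x_i^2. Rewriting
    by x_i^2 = m_i keeps the weight. It ends because m_i contains t, the variable of the least
    generator, which can be cancelled; the one exception is y^2 = xz. In multiplicity five the
    relations are x^2 = t^a y, xy = t^a z, z^2 = t^b x, yz = t^(a+b) and y^2 = xz. Modulo t only xz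
    = y^2 survives in degree 2, so the quotient of (t) by x is (t,x,y), while those of (t,x) by y
    and of (t,x,y) by z are the maximal ideal. *)

Definition wt n (a : 'I_n -> nat) (m : 'X_{1..n}) : nat := (\sum_i m i * a i)%N.

Lemma wtD n (a : 'I_n -> nat) m m' : wt a (m + m') = (wt a m + wt a m')%N.
Proof. by rewrite /wt -big_split; apply: eq_bigr => i _; rewrite mnmDE mulnDl. Qed.

Lemma wt0 n (a : 'I_n -> nat) : wt a 0%MM = 0%N.
Proof. by rewrite /wt big1 // => i _; rewrite mnm0E. Qed.

Lemma wtU n (a : 'I_n -> nat) i : wt a U_(i)%MM = a i.
Proof.
rewrite /wt (bigD1 i) //= mnm1E eqxx mul1n big1 ?addn0 // => j /negbTE ji.
by rewrite mnm1E eq_sym ji.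
Qed.

Lemma wtMn n (a : 'I_n -> nat) m k : wt a (m *+ k) = (wt a m * k)%N.
Proof. by rewrite /wt big_distrl; apply: eq_bigr => i _; rewrite mulmnE mulnAC. Qed.

Lemma mdeg_le_wt n (a : 'I_n -> nat) m : (forall i, (0 < a i)%N) -> (mdeg m <= wt a m)%N.
Proof. by move=> a0; rewrite mdegE; apply: leq_sum => i _; rewrite leq_pmulr. Qed.

Section Ideals.
Variables (K : fieldType) (n : nat).
Implicit Types (p q f g : {mpoly K[n]}) (S : {mpoly K[n]} -> Prop).

Section LinExt.
Variables (V : lmodType K) (phi : 'X_{1..n} -> V).

(** Several maps below, such as [symbol], are linear and given on monomials but not multiplicative,
    so evaluation of polynomials does not cover them. *)
Definition linext p : V := \sum_(m <- msupp p) p@_m *: phi m.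

Lemma linextwE k p : (msize p <= k)%N ->
  linext p = \sum_(m : 'X_{1..n < k}) p@_m *: phi m.
Proof.
move=> le_pk; pose I : subFinType _ := 'X_{1..n < k}.
rewrite /linext (big_mksub I) //=; first last.
  by move=> x /msize_mdeg_lt /leq_trans; apply.
  by rewrite msupp_uniq.
by rewrite big_rmcond //= => i; move/memN_msupp_eq0 ->; rewrite scale0r.
Qed.

Lemma linext_is_linear : linear linext.
Proof.
move=> c p q; pose k := maxn (msize (c *: p + q)) (maxn (msize p) (msize q)).
rewrite !(@linextwE k) ?leq_max ?leqnn ?orbT // scaler_sumr -big_split /=.
by apply: eq_bigr => m _; rewrite mcoeffD mcoeffZ scalerDl scalerA.
Qed.

HB.instance Definition _ :=
  GRing.isLinear.Build K {mpoly K[n]} V _ linext linext_is_linear.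

Lemma linextX m : linext 'X_[m] = phi m.
Proof. by rewrite /linext msuppX big_seq1 mcoeffX eqxx scale1r. Qed.
End LinExt.

Lemma hcompE d p m : (hcomp d p)@_m = if mdeg m == d then p@_m else 0.
Proof.
rewrite /hcomp raddf_sum /=.
under eq_bigr do rewrite mcoeffZ mcoeffX.
case: ifP => [/eqP md|md]; last first.
  rewrite big1_seq // => m' /andP[/eqP m'd _]; case: eqP => [e|]; last by rewrite mulr0.
  by rewrite -e m'd eqxx in md.
rewrite big_rmcond_in /=; last first.
  move=> m' _ m'd; case: eqP => [e|]; last by rewrite mulr0.
  by rewrite e md eqxx in m'd.
by rewrite [in RHS](mpolyE p) raddf_sum /=; apply: eq_bigr => m' _; rewrite mcoeffZ mcoeffX.
Qed.

Lemma hcomp_pihomog d p : hcomp d p = pihomog mdeg d p.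
Proof. by []. Qed.

Lemma homogeneousP d p : reflect (forall m, mdeg m != d -> p@_m = 0) (homogeneous d p).
Proof.
apply: (iffP allP) => h m.
  by apply: contraNeq; rewrite -mcoeff_msupp; apply: h.
by rewrite mcoeff_msupp; apply: contraNT => /h/eqP.
Qed.

Lemma hcomp_homogeneous d p : homogeneous d (hcomp d p).
Proof. by apply/homogeneousP => m /negbTE md; rewrite hcompE md. Qed.

Lemma hcomp_id d p : homogeneous d p -> hcomp d p = p.
Proof.
move=> /homogeneousP h; apply/mpolyP => m; rewrite hcompE.
by case: eqP => // /eqP /h ->.
Qed.

Lemma hcomp_ne d e p : d != e -> homogeneous e p -> hcomp d p = 0.
Proof.
move=> de /homogeneousP h; apply/mpolyP => m; rewrite hcompE mcoeff0.
by case: eqP => // md; apply: h; rewrite md.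
Qed.

Lemma hcompD d : {morph @hcomp K n d : p q / p + q}.
Proof. exact: pihomogD. Qed.

Lemma hcompB d : {morph @hcomp K n d : p q / p - q}.
Proof. exact: pihomogB. Qed.

Lemma hcompZ d c p : hcomp d (c *: p) = c *: hcomp d p.
Proof. by rewrite hcomp_pihomog linearZ. Qed.

Lemma hcomp0 d : @hcomp K n d 0 = 0.
Proof. exact: pihomog0. Qed.

Lemma hcomp_sum d (I : Type) (r : seq I) P (F : I -> {mpoly K[n]}) :
  hcomp d (\sum_(i <- r | P i) F i) = \sum_(i <- r | P i) hcomp d (F i).
Proof. by rewrite hcomp_pihomog raddf_sum. Qed.

Lemma hcomp_partition p : p = \sum_(d < msize p) hcomp d p.
Proof. exact: pihomog_partitionE. Qed.

Lemma mcoeffMXr p m k :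
  (p * 'X_[m])@_k = if (m <= k)%MM then p@_(k - m) else 0.
Proof.
case: ifP => [le_mk|/negP le_mk]; first by rewrite -{1}(submK le_mk) addmC mcoeffMX.
apply: memN_msupp_eq0; rewrite (perm_mem (msuppMX p m)).
by apply/mapP => -[m' _ e]; apply: le_mk; rewrite e lem_addr.
Qed.

Lemma homogeneousM d e p q :
  homogeneous d p -> homogeneous e q -> homogeneous (d + e) (p * q).
Proof. exact: dhomogM. Qed.

Lemma hcompMr d e p q : homogeneous e q ->
  hcomp (d + e) (p * q) = hcomp d p * q.
Proof.
move=> hq; rewrite {1}(hcomp_partition p) mulr_suml hcomp_sum.
rewrite (eq_bigr (fun i : 'I_(msize p) => if val i == d then hcomp i p * q else 0)).
  rewrite -big_mkcond /=; case: (ltnP d (msize p)) => dp.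
    by rewrite (big_pred1 (Ordinal dp)).
  rewrite big_pred0; last first.
    by move=> i; apply/eqP => id; move: (ltn_ord i); rewrite id ltnNge dp.
  suff -> : hcomp d p = 0 by rewrite mul0r.
  apply/mpolyP => m; rewrite hcompE mcoeff0; case: eqP => // md.
  by apply: memN_msupp_eq0; apply: msize_mdeg_ge; rewrite md.
move=> i _; have h := homogeneousM (hcomp_homogeneous i p) hq.
case: eqP => [id|/eqP id]; first by rewrite -id hcomp_id.
by apply: hcomp_ne h; rewrite eqn_add2r eq_sym.
Qed.

Lemma in_idealW S p : S p -> in_ideal S p.
Proof.
move=> Sp; exists 1%N, (fun _ => p), (fun _ => 1); split => //.
by rewrite big_ord1 mul1r.
Qed.

Lemma in_ideal0 S : in_ideal S 0.
Proof. by exists 0%N, (fun _ => 0), (fun _ => 0); split=> [[]//|]; rewrite big_ord0. Qed.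

Lemma in_idealD S p q : in_ideal S p -> in_ideal S q -> in_ideal S (p + q).
Proof.
move=> [k [g [c [Sg ->]]]] [k' [g' [c' [Sg' ->]]]].
exists (k + k')%N, (fun i => match split i with inl j => g j | inr j => g' j end),
  (fun i => match split i with inl j => c j | inr j => c' j end); split.
  by move=> i; case: split.
rewrite big_split_ord /=; congr (_ + _); apply: eq_bigr => i _.
  by rewrite -[lshift _ _]/(unsplit (inl i)) unsplitK.
by rewrite -[rshift _ _]/(unsplit (inr i)) unsplitK.
Qed.

Lemma in_idealM S r p : in_ideal S p -> in_ideal S (r * p).
Proof.
move=> [k [g [c [Sg ->]]]]; exists k, g, (fun i => r * c i); split => //.
by rewrite mulr_sumr; apply: eq_bigr => i _; rewrite mulrA.
Qed.

Lemma in_ideal_is_ideal S : is_ideal (in_ideal S).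
Proof. by split; [apply: in_ideal0|apply: in_idealD|apply: in_idealM]. Qed.

Lemma in_ideal_min S (I : {mpoly K[n]} -> Prop) p :
  is_ideal I -> (forall q, S q -> I q) -> in_ideal S p -> I p.
Proof.
move=> [I0 ID IM] SI [k [g [c [Sg ->]]]].
by elim/big_ind: _ => // i _; apply: IM; apply: SI.
Qed.
End Ideals.

Section IdealTheory.
Variables (K : fieldType) (n : nat) (I : {mpoly K[n]} -> Prop).
Hypothesis idI : is_ideal I.

Lemma ideal0 : I 0. Proof. by case: idI. Qed.
Lemma idealD p q : I p -> I q -> I (p + q). Proof. by case: idI => _ + _; apply. Qed.
Lemma idealM r p : I p -> I (r * p). Proof. by case: idI => _ _; apply. Qed.
Lemma idealMC r p : I p -> I (p * r). Proof. by rewrite mulrC; apply: idealM. Qed.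
Lemma idealN p : I p -> I (- p). Proof. by rewrite -mulN1r; apply: idealM. Qed.
Lemma idealB p q : I p -> I q -> I (p - q).
Proof. by move=> Ip /idealN; apply: idealD. Qed.
Lemma idealZ c p : I p -> I (c *: p).
Proof. by rewrite -mul_mpolyC; apply: idealM. Qed.
Lemma ideal_sum (J : Type) (r : seq J) (P : pred J) F :
  (forall i, P i -> I (F i)) -> I (\sum_(i <- r | P i) F i).
Proof. by move=> IF; elim/big_ind: _; [apply: ideal0|apply: idealD|]. Qed.
End IdealTheory.

Section ToricIdeal.
Variables (K : fieldType) (n : nat) (a : 'I_n -> nat).
Implicit Types (f g p q : {mpoly K[n]}).

Lemma evalHE p : evalH a p = linext (fun m => 'X^(wt a m) : {poly K}) p.
Proof.
rewrite /evalH /mmap /linext; apply: eq_bigr => m _.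
rewrite mul_polyC; congr (_ *: _).
by rewrite /mmap1 /wt -prodrXr; apply: eq_bigr => i _; rewrite -exprM mulnC.
Qed.

Lemma coef_evalH p h : (evalH a p)`_h = \sum_(m <- msupp p | wt a m == h) p@_m.
Proof.
rewrite evalHE /linext coef_sum [RHS]big_mkcond /=; apply: eq_bigr => m _.
by rewrite coefZ coefXn eq_sym; case: eqP => _; rewrite ?mulr1 ?mulr0.
Qed.

Lemma IHP p :
  IH a p <-> forall h, \sum_(m <- msupp p | wt a m == h) p@_m = 0.
Proof.
rewrite /IH; split=> [h0 h|h0]; first by rewrite -coef_evalH h0 coef0.
by apply/polyP => h; rewrite coef_evalH coef0.
Qed.

Lemma IH_is_ideal : is_ideal (@IH K n a).
Proof.
split=> [|p q Ip Iq|r p Ip]; rewrite /IH /evalH.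
- by rewrite mmap0.
- by rewrite mmapD [mmap _ _ p]Ip [mmap _ _ q]Iq addr0.
by rewrite rmorphM /= [X in _ * X]Ip mulr0.
Qed.

Lemma IH_binomial m m' : wt a m = wt a m' -> IH a ('X_[m] - 'X_[m'] : {mpoly K[n]}).
Proof. by move=> e; rewrite /IH evalHE raddfB /= !linextX e subrr. Qed.

(** When [m] is alone in its weight, the sum of coefficients that must vanish is the single
    coefficient at [m]. Unique factorizations thus obstruct membership in I_H. *)
Lemma IH_lone_coef f m : IH a f ->
  (forall m', wt a m' = wt a m -> m' = m) -> f@_m = 0.
Proof.
move=> /IHP /(_ (wt a m)) If um.
case: (boolP (m \in msupp f)) => [mf|/memN_msupp_eq0//].
rewrite big_mkcond (bigD1_seq m) //= eqxx in If.
rewrite big1 ?addr0 // in If => m' m'm; case: eqP => // /um e.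
by rewrite e eqxx in m'm.
Qed.

Lemma IHstar_is_ideal : is_ideal (@IHstar K n a).
Proof. exact: in_ideal_is_ideal. Qed.

Lemma IHstar_hcomp d f : IH a f -> (forall m, (mdeg m < d)%N -> f@_m = 0) ->
  IHstar a (hcomp d f).
Proof.
move=> If f0; case: (eqVneq (hcomp d f) 0) => [->|h0]; first exact: in_ideal0.
apply: in_idealW; exists f; split=> //; split.
  by apply: contraNneq h0 => ->; rewrite hcomp0.
exists d; split=> // d' d'd; apply/mpolyP => m; rewrite hcompE mcoeff0.
by case: eqP => // md; apply: f0; rewrite md.
Qed.

(* X^m times an initial form is again an initial form, so I_H^* is already
   spanned by initial forms as a vector space. *)
Lemma IHstar_ind (P : {mpoly K[n]} -> Prop) :
  P 0 -> (forall p q, P p -> P q -> P (p + q)) -> (forall c p, P p -> P (c *: p)) ->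
  (forall d f, IH a f -> (forall m, (mdeg m < d)%N -> f@_m = 0) -> P (hcomp d f)) ->
  forall p, IHstar a p -> P p.
Proof.
move=> P0 PD PZ Ph p [k [g [c [Sg ->]]]].
elim/big_ind: _ => // i _; have [f [If [_ [d [-> _ f0]]]]] := Sg i.
rewrite (mpolyE (c i)) mulr_suml; elim/big_ind: _ => // m _.
rewrite -scalerAl mulrC -(@hcompMr K n d (mdeg m)); last by rewrite /homogeneous msuppX /= eqxx.
apply/PZ/Ph; first exact: (idealMC IH_is_ideal).
move=> m' lt_m'; rewrite mcoeffMXr; case: ifP => // le_mm'.
have := congr1 mdeg (submK le_mm'); rewrite mdegD => e.
suff /(congr1 (mcoeff (m' - m)%MM)) : hcomp (mdeg (m' - m)) f = 0.
  by rewrite hcompE eqxx mcoeff0.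
by apply: f0; lia.
Qed.

Lemma IHstar_homog d p : IHstar a p -> IHstar a (hcomp d p).
Proof.
move: p; apply: IHstar_ind.
- by rewrite hcomp0; apply: in_ideal0.
- by move=> p q ? ?; rewrite hcompD; apply: in_idealD.
- by move=> c p ?; rewrite hcompZ; exact: (idealZ IHstar_is_ideal).
move=> e f If f0; case: (eqVneq d e) => [->|de].
  by rewrite hcomp_id ?hcomp_homogeneous //; apply: IHstar_hcomp.
by rewrite (hcomp_ne de) ?hcomp_homogeneous //; apply: in_ideal0.
Qed.

Lemma IHstar_lone_coef p m :
  (forall m', wt a m' = wt a m -> m' = m) -> IHstar a p -> p@_m = 0.
Proof.
move=> um; move: p; apply: IHstar_ind => [|p q|c p|d f /IH_lone_coef/(_ um) fm _].
- by rewrite mcoeff0.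
- by rewrite mcoeffD => -> ->; rewrite addr0.
- by rewrite mcoeffZ => ->; rewrite mulr0.
by rewrite hcompE fm; case: ifP.
Qed.

(* The initial form of x_i^(a_j) - x_j^(a_i) when a_j < a_i. *)
Lemma IHstar_Xn i j : (a j < a i)%N -> IHstar a ('X_[U_(i) *+ a j] : {mpoly K[n]}).
Proof.
move=> lt_ji; set f : {mpoly K[n]} := 'X_[U_(i) *+ a j] - 'X_[U_(j) *+ a i].
have -> : 'X_[U_(i) *+ a j] = hcomp (a j) f.
  apply/mpolyP => m; rewrite hcompE mcoeffB !mcoeffX.
  have ji : (U_(j) *+ a i)%MM = m -> mdeg m = a i by move=> <-; rewrite mdegMn mdeg1 mul1n.
  have ij : (U_(i) *+ a j)%MM = m -> mdeg m = a j by move=> <-; rewrite mdegMn mdeg1 mul1n.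
  case: (_ =P m) => [/ij eij|_]; case: (_ =P m) => [/ji e|_]; rewrite ?eij ?eqxx ?subr0 ?if_same //.
    by move: lt_ji; rewrite -eij e ltnn.
  by rewrite e gtn_eqF.
apply: IHstar_hcomp => [|m md].
  by apply: IH_binomial; rewrite !wtMn !wtU mulnC.
rewrite mcoeffB !mcoeffX; case: eqP => [e|_]; last case: eqP => [e|_]; rewrite ?subrr //;
  by move: md lt_ji; rewrite -e mdegMn mdeg1 mul1n; lia.
Qed.

(* If x_i^2 occurs in no quadric of I_H^*, no power of x_i lies in the ideal
   these quadrics generate. *)
Lemma quadratic_second_factorization i j : quadratic K a -> (a j < a i)%N ->
  exists2 m, wt a m = (a i).*2 & m != (U_(i) *+ 2)%MM.
Proof.
move=> qa lt_ji; apply: NNPP => none.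
have um m' : wt a m' = wt a (U_(i) *+ 2)%MM -> m' = (U_(i) *+ 2)%MM.
  rewrite wtMn wtU muln2 => e; apply/eqP/negPn/negP => ne; apply: none.
  by exists m'.
have [k [g [c [Sg]]]] := qa _ (@IHstar_Xn i j lt_ji).
move=> /(congr1 (mcoeff (U_(i) *+ a j)%MM)) /eqP.
rewrite mcoeffX eqxx raddf_sum big1 ?oner_eq0 // => t _ /=.
have [/(IHstar_lone_coef um) g0 /homogeneousP hg] := Sg t.
rewrite mcoeffM big1 // => -[m1 m2] /= /eqP e.
case: (eqVneq (mdeg m2) 2) => [m2d|/hg ->]; last by rewrite mulr0.
(* A divisor of a power of x_i is again a power of x_i, and [m2] has degree 2. *)
suff -> : (m2 : 'X_{1..n}) = (U_(i) *+ 2)%MM by rewrite g0 mulr0.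
apply/mnmP => l; rewrite mulmnE mnm1E.
have m2l l' : l' != i -> (m2 : 'X_{1..n}) l' = 0%N.
  move/negbTE => l'i; move: (congr1 (fun m : 'X_{1..n} => m l') e).
  by rewrite mulmnE mnm1E mnmDE (eq_sym i) l'i mul0n; move=> /esym/eqP; rewrite addn_eq0 => /andP[_ /eqP].
case: (eqVneq i l) => [<-|/negbTE il]; last by rewrite m2l // eq_sym il.
by move: m2d; rewrite mdegE (bigD1 i) //= big1 ?addn0.
Qed.
End ToricIdeal.

(** * Koszul algebras are quadratic *)

Lemma ideal_generated_by_linear (K : fieldType) n (I : {mpoly K[n]} -> Prop) p :
  is_ideal I -> (forall i, I 'X_i) -> p@_0%MM = 0 -> I p.
Proof.
move=> idI IX p0; rewrite (mpolyE p) big_seq; apply: ideal_sum => // m.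
rewrite mcoeff_msupp => pm; case: (pickP (fun i => m i != 0%N)) => [i mi|m0].
  have le_im : (U_(i) <= m)%MM by rewrite lep1mP.
  by rewrite -(submK le_im) mpolyXD; apply: idealZ => //; apply: idealM.
suff m00 : m = 0%MM by rewrite m00 p0 eqxx in pm.
by apply/mnmP => i; rewrite mnm0E; have /negbFE/eqP := m0 i.
Qed.

Section KoszulQuadratic.
Variables (K : fieldType) (n : nat) (J : {mpoly K[n]} -> Prop).
Hypothesis idJ : is_ideal J.
Hypothesis homJ : forall d p, J p -> J (hcomp d p).
Hypothesis J0 : forall p, J p -> p@_0%MM = 0.
Hypothesis J1 : forall p i, J p -> p@_U_(i) = 0.

Let Q (p : {mpoly K[n]}) := in_ideal (fun q => J q /\ homogeneous 2 q) p.

Lemma homogeneous_ideal_deg_le1 d p : (d <= 1)%N -> J p -> homogeneous d p -> p = 0.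
Proof.
move=> d1 Jp /homogeneousP hp; apply/mpolyP => m; rewrite mcoeff0.
case: (eqVneq (mdeg m) d) => [md|/hp//].
case: d md d1 {hp} => [|[|//]] md _.
  by move/eqP: md; rewrite mdeg_eq0 => /eqP ->; apply: J0.
have /mdeg1P[i /eqP ->] : mdeg m == 1%N by rewrite md.
exact: J1.
Qed.

Lemma koszul_ideal_quadratic : koszul_ideal J -> forall p, J p -> Q p.
Proof.
move=> [b [d0 [M [hd0 hM exA ex0 _]]]].
have idQ : is_ideal Q := in_ideal_is_ideal _.
(* Exactness gives this only modulo J. For a variable the parts of degree 1 are equal, since J has
   no linear forms; the variables suffice. *)
have lin p : p@_0%MM = 0 -> exists v : 'rV_(b 0%N), p = (v *m d0) 0 0.
  pose I p := exists v : 'rV_(b 0%N), p = (v *m d0) 0 0.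
  have idI : is_ideal I.
    split.
    - by exists 0; rewrite mul0mx mxE.
    - by move=> q r [v ->] [w ->]; exists (v + w); rewrite mulmxDl [in RHS]mxE.
    by move=> r q [v ->]; exists (r *: v); rewrite -scalemxAl [in RHS]mxE.
  move=> p0; apply: (ideal_generated_by_linear idI) p0 => i.
  have /exA[w /(homJ 1)] : ('X_i : {mpoly K[n]})@_0%MM = 0.
    by rewrite mcoeffX mnm1_eq0.
  have hX : homogeneous 1 ('X_i : {mpoly K[n]}) by rewrite /homogeneous msuppX /= mdeg1 eqxx.
  move/homogeneous_ideal_deg_le1 => /(_ 1%N isT (hcomp_homogeneous _ _))/eqP.
  rewrite hcompB (hcomp_id hX) subr_eq0 => /eqP ->.
  exists (map_mx (@hcomp K n 0) w); rewrite !mxE hcomp_sum.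
  by apply: eq_bigr => j _; rewrite mxE (@hcompMr _ _ 0 1).
suff Qhom d p : homogeneous d p -> J p -> Q p.
  move=> p Jp; rewrite (hcomp_partition p); apply: ideal_sum => // i _.
  by apply: (Qhom i); [apply: hcomp_homogeneous|apply: homJ].
have [d2|] := leqP d 2; last first.
  case: d => // d; rewrite ltnS => d2; elim: d d2 p => // d IHd d2 p hp Jp.
  have [v pv] := lin p (J0 Jp).
  have {}pv : p = ((map_mx (@hcomp K n d.+1) v) *m d0) 0 0.
    rewrite -(hcomp_id hp) pv !mxE hcomp_sum; apply: eq_bigr => j _.
    by rewrite mxE -(addn1 d.+1) (@hcompMr _ _ d.+1 1).
  have := Jp; rewrite pv => /ex0[w wJ].
  pose w' := map_mx (@hcomp K n d) w; pose u := map_mx (@hcomp K n d.+1) v - w' *m M 0%N.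
  have uJ j : J (u 0 j) /\ homogeneous d.+1 (u 0 j).
    suff -> : u 0 j = hcomp d.+1 ((map_mx (@hcomp K n d.+1) v - w *m M 0%N) 0 j).
      by split; [apply: homJ|apply: hcomp_homogeneous].
    rewrite /u !mxE hcompB (hcomp_id (hcomp_homogeneous _ _)); congr (_ - _).
    by rewrite hcomp_sum; apply: eq_bigr => i _; rewrite mxE -(addn1 d) (@hcompMr _ _ d 1).
  have -> : map_mx (@hcomp K n d.+1) v = u + w' *m M 0%N by rewrite subrK.
  (* The entries of [u] lie in J and have degree one less than p; those of [M 0 *m d0] are quadrics
     in J. *)
  rewrite mulmxDl -mulmxA mxE; apply: (idealD idQ).
    rewrite mxE; apply: (ideal_sum idQ) => j _; apply: (idealMC idQ).
    have [Ju hu] := uJ j; move: (d2); rewrite leq_eqVlt => /orP[/eqP e|d3]; last first.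
      by apply: IHd.
    by apply: in_idealW; rewrite e.
  rewrite mxE; apply: (ideal_sum idQ) => i _; apply: (idealM idQ); apply: in_idealW; split.
    have := ex0 (row i (M 0%N)); rewrite -row_mul mxE => ->.
    exists (delta_mx 0 i) => j; rewrite -rowE subrr mxE; exact: (ideal0 idJ).
  rewrite mxE; elim/big_ind: _ => [|q r|k _].
  - by rewrite /homogeneous msupp0.
  - by move=> /homogeneousP hq /homogeneousP hr; apply/homogeneousP => m md;
      rewrite mcoeffD hq // hr // addr0.
  by rewrite -[2%N]/(1 + 1)%N; apply: homogeneousM.
move=> hp Jp; case: (eqVneq d 2) hp => [->|dn2] hp; first exact: in_idealW.
by rewrite (homogeneous_ideal_deg_le1 _ Jp hp); [apply: in_ideal0|lia].
Qed.
End KoszulQuadratic.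

(** * Linear resolutions from a Koszul flag *)

(** Numbers in base r carry the lexicographic order on pairs; this makes the rank of a syzygy a
    single number. *)
Lemma lex_ltn r x x' i i' : (i < r)%N -> (i' < r)%N ->
  (x * r + i < x' * r + i')%N = (x < x')%N || (x == x') && (i < i')%N.
Proof.
move=> ir i'r; case: (ltngtP x x') => [xx'|xx'|->] /=; last by rewrite ltn_add2l.
  by have := leq_mul xx' (leqnn r); rewrite mulSn; lia.
by apply/negbTE; have := leq_mul xx' (leqnn r); rewrite mulSn; lia.
Qed.

Section KoszulFlag.
Variables (K : fieldType) (n : nat) (J : {mpoly K[n]} -> Prop).
Hypothesis idJ : is_ideal J.
Hypothesis homJ : forall d p, J p -> J (hcomp d p).
Variables (r : nat) (l : 'I_r -> {mpoly K[n]}) (sigma : 'I_r -> nat).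

Definition flag (k : nat) (p : {mpoly K[n]}) : Prop :=
  exists c : 'I_r -> {mpoly K[n]}, J (p - \sum_(i < r | (i < k)%N) c i * l i).

Hypothesis l_lin : forall i, homogeneous 1 (l i).
Hypothesis flag_max : forall p, p@_0%MM = 0 <-> flag r p.
(** With [colon_ge]: the ideal quotient of [flag i] by [l i] is [flag (sigma i)]. *)
Hypothesis colon_le : forall (i : 'I_r) p, flag i (p * l i) -> flag (sigma i) p.
Hypothesis colon_ge : forall (i i' : 'I_r), (i' < sigma i)%N -> flag i (l i' * l i).

Lemma flag_homog_coef k d p : homogeneous d.+1 p -> flag k p ->
  exists2 c : 'I_r -> {mpoly K[n]}, (forall i, homogeneous d (c i)) &
    J (p - \sum_(i < r | (i < k)%N) c i * l i).
Proof.
move=> hp [c /(homJ d.+1)]; rewrite hcompB hcomp_id // hcomp_sum => Jc.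
exists (fun i => hcomp d (c i)) => [i|]; first exact: hcomp_homogeneous.
congr (J (_ - _)): Jc; apply: eq_bigr => i _.
by rewrite -{1}(addn1 d) (@hcompMr _ _ d 1).
Qed.

Definition Jvec m (v : 'rV[{mpoly K[n]}]_m) := forall j, J (v 0 j).

Lemma JvecD m (v w : 'rV_m) : Jvec v -> Jvec w -> Jvec (v + w).
Proof. by move=> Jv Jw j; rewrite mxE; apply: (idealD idJ). Qed.

(* A syzygy module Z together with a ranking of the coordinates; typ j records
   the flag member formed by the leading coefficients at position j. *)
Record stage := Stage {
  dim : nat;
  rk : 'I_dim -> nat;
  typ : 'I_dim -> nat;
  syz : 'rV[{mpoly K[n]}]_dim -> Prop }.

(** The last two fields say that the leading coefficients at position j form exactly [flag (typ j)].
    The second asks for linear witnesses with exact zeros above j, because these become the rows of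
    the next matrix. *)
Record stage_valid (s : stage) : Prop := StageValid {
  rk_inj : injective (@rk s);
  syzJ : forall v, Jvec v -> @syz s v;
  syzD : forall v w, @syz s v -> @syz s w -> @syz s (v + w);
  syzZ : forall c v, @syz s v -> @syz s (c *: v);
  lead_le : forall v j, @syz s v ->
    (forall j', (@rk s j < @rk s j')%N -> J (v 0 j')) -> flag (@typ s j) (v 0 j);
  lead_ge : forall j (i : 'I_r), (i < @typ s j)%N ->
    exists v, [/\ @syz s v, (forall j', homogeneous 1 (v 0 j')), v 0 j = l i
      & forall j', (@rk s j < @rk s j')%N -> v 0 j' = 0] }.

Section Step.
Variable s : stage.

Definition next_idx := {x : 'I_(dim s) * 'I_r | (x.2 < @typ s x.1)%N}.
Definition next_dim := #|{: next_idx}|.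
Definition pos (t : 'I_next_dim) : 'I_(dim s) := (val (enum_val t)).1.
Definition gen (t : 'I_next_dim) : 'I_r := (val (enum_val t)).2.

(** As in Schreyer's order, a row is ranked by its leading position and then by its leading
    coefficient [l (gen t)]. The leading coefficients of the syzygies at t form the quotient of
    [flag (gen t)] by [l (gen t)], hence the type [sigma (gen t)]. *)
Definition next_stage (M : 'M[{mpoly K[n]}]_(next_dim, dim s)) : stage :=
  @Stage next_dim (fun t => (@rk s (pos t) * r + gen t)%N) (fun t => sigma (gen t))
    (fun w => Jvec (w *m M)).

Lemma gen_lt t : (gen t < @typ s (pos t))%N.
Proof. exact: (valP (enum_val t)). Qed.

Lemma pos_gen_inj t t' : pos t = pos t' -> gen t = gen t' -> t = t'.
Proof.
rewrite /pos /gen => e1 e2; apply/enum_val_inj/val_inj.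
by move: e1 e2; case: (val _) => ? ?; case: (val _) => ? ? /= -> ->.
Qed.

Lemma pos_gen_surj j (i : 'I_r) : (i < @typ s j)%N -> exists2 t, pos t = j & gen t = i.
Proof.
move=> ij; exists (enum_rank (Sub (j, i) ij : next_idx)).
  by rewrite /pos enum_rankK.
by rewrite /gen enum_rankK.
Qed.

Lemma sum_gen j k (F : 'I_r -> {mpoly K[n]}) : (k <= @typ s j)%N ->
  \sum_(t | (pos t == j) && (gen t < k)%N) F (gen t) = \sum_(i < r | (i < k)%N) F i.
Proof.
move=> kj; rewrite (partition_big gen (fun i : 'I_r => (i < k)%N)) /=; last by move=> t /andP[].
apply: eq_bigr => i ik; have [t pt gt] := pos_gen_surj (leq_trans ik kj).
rewrite (big_pred1 t) ?gt // => t' /=; apply/andP/eqP => [[/andP[/eqP p' _] /eqP g']|->].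
  by apply: pos_gen_inj; rewrite ?pt ?gt.
by rewrite pt gt !eqxx ik.
Qed.

Hypothesis sv : stage_valid s.

Definition step_spec (M : 'M[{mpoly K[n]}]_(next_dim, dim s)) :=
  [/\ forall t j, homogeneous 1 (M t j),
      forall v, @syz s v <-> exists w, Jvec (v - w *m M)
    & stage_valid (next_stage M)].

Lemma stage_step : exists M, step_spec M.
Proof.
have [f fP] := fin_all_exists (fun t => lead_ge sv (gen_lt t)).
pose M : 'M[{mpoly K[n]}]_(next_dim, dim s) := \matrix_(t, j) f t 0 j.
have Mrow t : row t M = f t by apply/rowP => j; rewrite !mxE.
have syzM w : @syz s (w *m M).
  rewrite mulmx_sum_row; elim/big_ind: _ => [|v v'|t _].
  - by apply: (syzJ sv) => j; rewrite mxE; apply: (ideal0 idJ).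
  - exact: (syzD sv).
  by rewrite Mrow; apply: (syzZ sv); case: (fP t).
have Mlin t j : homogeneous 1 (M t j) by rewrite mxE; case: (fP t).
have Mpos t : M t (pos t) = l (gen t) by rewrite mxE; case: (fP t).
have M0 t j : (@rk s (pos t) < @rk s j)%N -> M t j = 0.
  by rewrite mxE; case: (fP t) => _ _ _; apply.
(* Division by the rows of [M]: the coordinate of highest rank is cleared by the rows leading there,
   then the next one. The bound on the support of [w] keeps later corrections away from leading
   entries. *)
have span N v : @syz s v -> (forall j, (N <= @rk s j)%N -> J (v 0 j)) ->
    exists2 w : 'rV_next_dim, (forall t, (N <= @rk s (pos t))%N -> w 0 t = 0)
      & Jvec (v - w *m M).
  elim: N v => [|N IHN] v Zv Jv.
    by exists 0 => [t _|j]; rewrite ?mul0mx ?subr0 ?mxE //; apply: Jv.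
  case: (pickP (fun j => @rk s j == N)) => [j /eqP rj|noj]; last first.
    have [|w w0 Jw] := IHN v Zv.
      by move=> j Nj; apply: Jv; rewrite ltn_neqAle eq_sym noj.
    by exists w => // t /ltnW; apply: w0.
  have [|c Jc] := lead_le sv (j := j) Zv; first by move=> j'; rewrite rj; apply: Jv.
  pose w1 : 'rV_next_dim := \row_t (if pos t == j then c (gen t) else 0).
  have w1M j' : (w1 *m M) 0 j' = \sum_(t | pos t == j) c (gen t) * M t j'.
    rewrite mxE [RHS]big_mkcond; apply: eq_bigr => t _; rewrite mxE.
    by case: ifP; rewrite ?mul0r.
  have [|j' Nj'|w2 w20 Jw2] := IHN (v - w1 *m M).
  - by rewrite -mulNmx; apply: (syzD sv).
  - rewrite mxE [X in _ + X]mxE w1M; move: Nj'; rewrite leq_eqVlt => /orP[/eqP Nj'|Nj'].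
      have -> : j' = j by apply: (rk_inj sv); rewrite rj.
      rewrite -(@sum_gen j _ (fun i => c i * l i) (leqnn _)) in Jc.
      congr (J (_ - _)): Jc; apply: eq_big => [t|t /andP[/eqP <- _]]; last by rewrite Mpos.
      by case: eqP => //= <-; rewrite gen_lt.
    rewrite big1 ?subr0; first exact: Jv.
    by move=> t /eqP tj; rewrite M0 ?mulr0 // tj rj.
  exists (w1 + w2) => [t Nt|].
    by rewrite !mxE w20 1?ltnW // addr0; case: eqP => // tj; rewrite tj rj ltnn in Nt.
  by rewrite mulmxDl opprD addrA.
exists M; split=> //.
  move=> v; split=> [Zv|[w Jw]]; last first.
    by rewrite -(subrK (w *m M) v); apply: (syzD sv) => //; apply: (syzJ sv).
  have [|w _ Jw] := span (\max_j @rk s j).+1 v Zv; last by exists w.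
  by move=> j; rewrite ltnNge leq_bigmax.
split=> /=.
- move=> t t' e.
  have := lex_ltn (@rk s (pos t)) (@rk s (pos t')) (ltn_ord (gen t)) (ltn_ord (gen t')).
  have := lex_ltn (@rk s (pos t')) (@rk s (pos t)) (ltn_ord (gen t')) (ltn_ord (gen t)).
  rewrite e ltnn => h1 h2.
  have rr : @rk s (pos t) = @rk s (pos t') by lia.
  by apply: pos_gen_inj; [apply: (rk_inj sv)|apply: ord_inj; lia].
- move=> v Jv j; rewrite mxE; apply: (ideal_sum idJ) => t _.
  exact: (idealMC idJ).
- by move=> v w Jv Jw; rewrite mulmxDl; apply: JvecD.
- by move=> c v Jv j; rewrite -scalemxAl mxE; apply: (idealM idJ).
(* In coordinate [pos t] of [w *m M], rows leading at a lower rank vanish and rows ranked after [t]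
   have coefficients in J. The others lead there with an earlier [l], so [w 0 t * l (gen t)] is in
   [flag (gen t)]. *)
- move=> w t Jw w0; apply: colon_le.
  pose j := pos t; have := Jw j; rewrite mxE.
  rewrite (bigID (fun t' => (@rk s (pos t') * r + gen t' <= @rk s j * r + gen t)%N)) /=.
  set A := \sum_(t' | _) _; set B := \sum_(t' | _) _ => JAB.
  have JA : J A.
    rewrite -(addrK B A); apply: (idealB idJ) => //; apply: (ideal_sum idJ) => t'.
    by rewrite -ltnNge => /w0; apply: (idealMC idJ).
  exists (fun i => - \sum_(t' | (pos t' == j) && (gen t' == i)) w 0 t').
  rewrite (_ : _ - _ = A) // /A (bigD1 t) //= Mpos; congr (_ + _).
  under eq_bigr do rewrite mulNr; rewrite sumrN opprK.
  transitivity (\sum_(t' | (pos t' == j) && (gen t' < gen t)%N) w 0 t' * l (gen t')).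
    rewrite [RHS](partition_big gen (fun i : 'I_r => (i < gen t)%N)) /=; last by move=> t' /andP[].
    apply: eq_bigr => i it; rewrite mulr_suml; apply: eq_big => [t'|t' /andP[_ /eqP ->] //].
    by case: (gen t' =P i) => [->|]; rewrite ?it ?andbT ?andbF.
  rewrite [LHS]big_mkcond [RHS]big_mkcond /=; apply: eq_bigr => t' _.
  rewrite [in RHS]leq_eqVlt lex_ltn //.
  case: (t' =P t) => [->|t't]; first by rewrite /= ltnn !andbF.
  case: (pos t' =P j) => [p'|p'] /=.
    rewrite p' ltnn eqxx /= eqn_add2l andbT; case: ltngtP => //= [_|g'].
      by rewrite -Mpos p'.
    by case: t't; apply: pos_gen_inj => //; apply: ord_inj.
  rewrite andbT; case: ifP => // h; rewrite M0 ?mulr0 //.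
  have ne : @rk s (pos t') <> @rk s j by move/(rk_inj sv).
  have := lex_ltn (@rk s j) (@rk s (pos t')) (ltn_ord (gen t)) (ltn_ord (gen t')).
  by lia.
(* Writing [l i2 * l (gen t)] through the earlier [l] gives a linear [w0] for which [w0 *m M] is
   zero modulo J from the rank of j on; [span] removes the rest by rows leading below j. *)
move=> t i2 i2t; pose j := pos t.
have hll : homogeneous 2 (l i2 * l (gen t)) by apply: (@homogeneousM _ _ 1 1).
have [c hc Jc] := flag_homog_coef hll (colon_ge i2t).
pose w0 : 'rV_next_dim := \row_t' (if t' == t then l i2 else
  if (pos t' == j) && (gen t' < gen t)%N then - c (gen t') else 0).
have hw0 t' : homogeneous 1 (w0 0 t').
  rewrite mxE; case: eqP => // _; case: ifP => _; last by rewrite /homogeneous msupp0.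
  by apply/homogeneousP => m /(homogeneousP _ _ (hc _)) cm; rewrite mcoeffN cm oppr0.
have w0M j' : (w0 *m M) 0 j' = l i2 * M t j'
    - \sum_(t' | (pos t' == j) && (gen t' < gen t)%N) c (gen t') * M t' j'.
  rewrite mxE (bigD1 t) //= mxE eqxx; congr (_ + _).
  rewrite -sumrN [LHS]big_mkcond [RHS]big_mkcond; apply: eq_bigr => t' _; rewrite mxE.
  case: (t' =P t) => [->|_] /=; first by rewrite ltnn andbF.
  by case: ifP; rewrite ?mulNr ?mul0r.
have [j' jj'|w2 w20 Jw2] := span (@rk s j) (w0 *m M) (syzM _).
  rewrite w0M; move: jj'; rewrite leq_eqVlt => /orP[/eqP jj'|jj'].
    have -> : j' = j by apply: (rk_inj sv).
    rewrite Mpos; congr (J (_ - _)): Jc.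
    rewrite -(@sum_gen j _ (fun i => c i * l i)); last by apply: ltnW; apply: gen_lt.
    by apply: eq_bigr => t' /andP[/eqP <- _]; rewrite Mpos.
  rewrite M0 // mulr0 big1 ?subr0; first exact: (ideal0 idJ).
  by move=> t' /andP[/eqP pt' _]; rewrite M0 ?mulr0 // pt'.
(* Since [w0 *m M] has entries of degree 2 and [M] is linear, the part of degree 1 of [w2] does the
   same work. *)
pose w2' := map_mx (@hcomp K n 1) w2.
exists (w0 - w2'); split=> [|t'||t' tt'].
- move=> j'; move/(homJ 2): (Jw2 j'); congr J.
  have mxB (A B : 'rV[{mpoly K[n]}]_(dim s)) : (A - B) 0 j' = A 0 j' - B 0 j'.
    by rewrite mxE [X in _ + X]mxE.
  rewrite mulmxBl !mxB hcompB; congr (_ - _).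
    rewrite mxE hcomp_sum; apply: eq_bigr => t' _; rewrite hcomp_id //.
    exact: (@homogeneousM _ _ 1 1).
  rewrite mxE [in RHS]mxE hcomp_sum; apply: eq_bigr => t' _.
  by rewrite [w2' _ _]mxE -(@hcompMr _ _ 1 1).
- rewrite mxE; apply/homogeneousP => m m1; rewrite mcoeffD.
  by rewrite (homogeneousP _ _ (hw0 _)) // !mxE mcoeffN hcompE (negbTE m1) subr0.
- by rewrite !mxE eqxx w20 // hcomp0 subr0.
rewrite lex_ltn // in tt'; rewrite !mxE w20 ?hcomp0 ?subr0; last first.
  by case/orP: tt' => [/ltnW//|/andP[/eqP e _]]; rewrite /j e.
case: eqP => [e|_]; first by rewrite e !ltnn andbF in tt'.
case: ifP => // /andP[/eqP pt' gt']; rewrite pt' /j ltnn eqxx /= in tt'.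
by rewrite ltnNge ltnW in gt'.
Qed.
End Step.

Lemma koszul_of_flag : koszul_ideal J.
Proof.
(* The maximal ideal of A as a submodule of A, with one coordinate. *)
pose s0 := @Stage 1 (fun _ => 0%N) (fun _ => r) (fun v => (v 0 0)@_0%MM = 0).
have sv0 : stage_valid s0.
  have J0 p : J p -> p@_0%MM = 0.
    move=> Jp; apply/flag_max; exists (fun _ => 0).
    by rewrite big1 ?subr0 // => i _; rewrite mul0r.
  split=> /= [x y _|v Jv|v w v0 w0|c v v0|v j v0 _|j i _].
  - by rewrite !ord1.
  - exact: J0.
  - by rewrite mxE mcoeffD v0 w0 addr0.
  - by rewrite mxE mcoeffM big1 // => -[m1 m2] /= /eqP/esym/eqP;
      rewrite mnmD_eq0 => /andP[_ /eqP ->]; rewrite v0 mulr0.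
  - by apply/flag_max; rewrite (ord1 j).
  exists (const_mx (l i)); split=> [|j'||j']; rewrite ?mxE //.
  by apply: (homogeneousP _ _ (l_lin i)); rewrite mdeg0.
(* The dimensions of a stage depend on the stage before it, so stages are iterated together with
   their validity, and each matrix is picked by choice. *)
pose step (s : sig stage_valid) :=
  constructive_indefinite_description _ (stage_step (proj2_sig s)).
pose next (s : sig stage_valid) : sig stage_valid :=
  exist _ _ (let: And3 _ _ v := proj2_sig (step s) in v).
pose st k := iter k next (exist _ s0 sv0).
exists (fun i => dim (proj1_sig (st i.+1))), (proj1_sig (step (st 0%N))),
  (fun i => proj1_sig (step (st i.+1))).
have stM i : step_spec (proj1_sig (step (st i))) by apply: proj2_sig.
split.
- by move=> j; have [+ _ _] := stM 0%N; apply.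
- by move=> i j k; have [+ _ _] := stM i.+1; apply.
- move=> p; have [_ /(_ (const_mx p)) + _] := stM 0%N; rewrite /= mxE => ->.
  split=> -[w Jw]; exists w; first by have := Jw 0; rewrite !mxE.
  by move=> j; move: Jw; rewrite (ord1 j) !mxE.
- move=> v; have [_ /(_ v) <- _] := stM 1%N.
  change (J ((v *m proj1_sig (step (st 0%N))) 0 0) <-> Jvec (v *m proj1_sig (step (st 0%N)))).
  by split=> Jv; [move=> j; rewrite (ord1 j)|exact: (Jv 0)].
by move=> i v; have [_ + _] := stM i.+2; apply.
Qed.
End KoszulFlag.

(** * The height of a toric ideal *)

Section LinExtMultiplicative.
Variables (K : fieldType) (n : nat) (V : comAlgType K) (phi : 'X_{1..n} -> V).
Hypothesis phi0 : phi 0%MM = 1.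
Hypothesis phiD : forall m m', phi (m + m')%MM = phi m * phi m'.

Lemma linextM p q : linext phi (p * q) = linext phi p * linext phi q.
Proof.
rewrite (mpolyE p) (mpolyE q) mulr_suml !linear_sum mulr_suml.
apply: eq_bigr => m _; rewrite linearZ /= -scalerAl linearZ -scalerAl /=; congr (_ *: _).
rewrite mulr_sumr linear_sum mulr_sumr; apply: eq_bigr => m' _.
by rewrite -scalerAr !linearZ /= -mpolyXD !linextX phiD -scalerAr.
Qed.
End LinExtMultiplicative.

Lemma prime_ideal_ker (K : fieldType) n (V : comAlgType K) (phi : 'X_{1..n} -> V) :
  phi 0%MM = 1 -> (forall m m', phi (m + m')%MM = phi m * phi m') ->
  (forall x y : V, x * y = 0 -> x = 0 \/ y = 0) ->
  prime_ideal (fun p => linext phi p = 0).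
Proof.
move=> phi0 phiD Vdom; split.
- split=> [|p q p0 q0|r p p0]; first exact: linear0.
    by rewrite linearD /= p0 q0 addr0.
  by rewrite linextM // p0 mulr0.
- by rewrite -mpolyX0 linextX phi0 => /eqP; rewrite oner_eq0.
by move=> p q; rewrite linextM // => /Vdom.
Qed.

(** * A chain of primes ending in a toric ideal *)

Section Chain.
Variables (K : fieldType) (n : nat) (a : 'I_n.+1 -> nat).
Hypothesis a_gt0 : forall i, (0 < a i)%N.
Local Notation S := {mpoly K[n.+1]}.

(* The exponent map of x_i |-> x_0^(a_i) for i <= k, x_i |-> x_i for i > k. *)
Definition collapse k (m : 'X_{1..n.+1}) : 'X_{1..n.+1} :=
  (\sum_(i < n.+1) (if (i <= k)%N then U_(ord0) *+ (m i * a i) else U_(i) *+ m i))%MM.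

Definition collapse_ker k (p : S) := linext (fun m => 'X_[collapse k m] : S) p = 0.

Lemma collapseD k m m' : collapse k (m + m') = (collapse k m + collapse k m')%MM.
Proof.
rewrite /collapse -big_split; apply: eq_bigr => i _ /=; rewrite mnmDE.
by case: ifP => _; apply/mnmP => j; rewrite !mnmDE !mulmnE ?mulnDl mulnDr.
Qed.

Lemma collapse0 k : collapse k 0%MM = 0%MM.
Proof.
rewrite /collapse big1 // => i _; rewrite mnm0E mul0n.
by case: ifP => _; apply: mulm0n.
Qed.

Lemma collapseU k (i : 'I_n.+1) c :
  collapse k (U_(i) *+ c) = if (i <= k)%N then (U_(ord0) *+ (c * a i))%MM else (U_(i) *+ c)%MM.
Proof.
rewrite /collapse (bigD1 i) //= big1 ?addm0.
  by rewrite mulmnE mnm1E eqxx mul1n.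
move=> j /negbTE ji; rewrite mulmnE mnm1E (eq_sym i) ji mul0n.
by case: ifP => _; apply: mulm0n.
Qed.

Lemma collapse_ker_prime k : prime_ideal (collapse_ker k).
Proof.
apply: prime_ideal_ker => [|m m'|x y /eqP].
- by rewrite collapse0 mpolyX0.
- by rewrite collapseD mpolyXD.
by rewrite mulf_eq0 => /orP[] /eqP; [left|right].
Qed.

(** Sending x_(k+1) to its power of x_0 and fixing the other variables turns [collapse k] into
    [collapse k.+1], so kernels grow. *)
Lemma collapse_ker_sub k p : collapse_ker k p -> collapse_ker k.+1 p.
Proof.
rewrite /collapse_ker => pk.
pose psi (m : 'X_{1..n.+1}) : 'X_{1..n.+1} := (\sum_(i < n.+1)
  (if val i == k.+1 then U_(ord0) *+ (m i * a i) else U_(i) *+ m i))%MM.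
have psiD m m' : psi (m + m')%MM = (psi m + psi m')%MM.
  rewrite /psi -big_split; apply: eq_bigr => i _ /=; rewrite mnmDE.
  by case: ifP => _; apply/mnmP => j; rewrite !mnmDE !mulmnE ?mulnDl mulnDr.
have psi0 : psi 0%MM = 0%MM.
  rewrite /psi big1 // => i _; rewrite mnm0E mul0n.
  by case: ifP => _; apply: mulm0n.
have psiU i c : psi (U_(i) *+ c)%MM =
    if val i == k.+1 then (U_(ord0) *+ (c * a i))%MM else (U_(i) *+ c)%MM.
  rewrite /psi (bigD1 i) //= big1 ?addm0.
    by rewrite mulmnE mnm1E eqxx mul1n.
  move=> j /negbTE ji; rewrite mulmnE mnm1E (eq_sym i) ji mul0n.
  by case: ifP => _; apply: mulm0n.
have psiE m : psi (collapse k m) = collapse k.+1 m.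
  rewrite {1}/collapse (big_morph psi psiD psi0); apply: eq_bigr => i _.
  case: (ltngtP i k.+1) => ik; rewrite ?ltnS in ik.
  - by rewrite ik psiU.
  - by rewrite leqNgt ltnW //= psiU gtn_eqF.
  by rewrite ik ltnn psiU /= ik eqxx.
move/(congr1 (linext (fun m => 'X_[psi m] : S))): pk.
rewrite linear0 [X in linext _ X]/linext linear_sum => <-; apply: eq_bigr => m _.
by rewrite linearZ /= linextX psiE.
Qed.

Lemma collapse_ker_IH p : collapse_ker n p <-> IH a p.
Proof.
have cE m : collapse n m = (U_(ord0) *+ wt a m)%MM.
  apply/mnmP => j; rewrite /collapse mnm_sumE mulmnE /wt big_distrr /=.
  by apply: eq_bigr => i _; rewrite -ltnS ltn_ord mulmnE.
split=> [|Ip].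
  (* Weight 1 for x_0 maps x_0^(wt a m) to the image of m in K[H]. *)
  pose b (i : 'I_n.+1) := if i == ord0 then 1%N else a i.
  move/(congr1 (evalH b)); rewrite /IH !evalHE linear0 [X in linext _ X]/linext linear_sum => <-.
  apply: eq_bigr => m _; rewrite linearZ /= linextX cE wtMn wtU /b eqxx mul1n.
  by [].
rewrite /collapse_ker.
transitivity (map_poly (@mpolyC n.+1 K) (evalH a p)).['X_ord0].
  rewrite evalHE {1}/linext /linext rmorph_sum horner_sum; apply: eq_bigr => m _.
  by rewrite -mul_polyC rmorphM /= map_polyC map_polyXn hornerM hornerC hornerXn cE mpolyXn mul_mpolyC.
by rewrite Ip rmorph0 horner0.
Qed.

Lemma IH_prime_chain : prime_chain_to (@IH K _ a) n.
Proof.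
exists collapse_ker; split=> [i _|k kn|]; [exact: collapse_ker_prime| |exact: collapse_ker_IH].
split; first exact: collapse_ker_sub.
have k1n : (k.+1 < n.+1)%N by [].
(* Strictness: [collapse k] leaves x_(k+1) alone, so it separates the two terms that [collapse k.+1]
   identifies. *)
pose i := Ordinal k1n; exists ('X_[U_(i) *+ a ord0] - 'X_[U_(ord0) *+ a i]); split.
  by rewrite /collapse_ker linearB /= !linextX !collapseU /= leqnn mulnC subrr.
rewrite /collapse_ker linearB /= !linextX !collapseU /= ltnn.
move/eqP; rewrite subr_eq0 => /eqP/(congr1 (mcoeff (U_(i) *+ a ord0)%MM)).
rewrite !mcoeffX eqxx; case: eqP => [e _|_ /eqP h]; last by case/negP: (oner_neq0 K).
have := congr1 (fun m : 'X_{1..n.+1} => m i) e.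
rewrite !mulmnE !mnm1E eqxx /= mul0n mul1n => a0.
by have := a_gt0 ord0; rewrite -a0.
Qed.
End Chain.

(** * Algebraic independence modulo a prime bounds chains *)

Section TranscendenceDegree.
Variables (K : fieldType) (n : nat).
Local Notation S := {mpoly K[n]}.
Implicit Types (P Q : S -> Prop) (ys : seq S).

(* The base-N digits of k are the exponents. *)
Fixpoint digit_mon N ys k : S :=
  if ys is y :: ys' then y ^+ (k %% N)%N * digit_mon N ys' (k %/ N)%N else 1.

(** Algebraic independence in the quotient by P. The monomials with exponents below N are indexed by
    one number, which makes a relation a sequence and later a row vector. *)
Definition alg_indep P ys := forall N (c : nat -> K),
  P (\sum_(k < N ^ size ys) c k *: digit_mon N ys k) ->
  forall k, (k < N ^ size ys)%N -> c k = 0.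

Lemma sum_digits (V : nmodType) N A (F : nat -> V) :
  \sum_(k < N * A) F k = \sum_(j < N) \sum_(k < A) F (k * N + j)%N.
Proof.
rewrite exchange_big /= mulnC; elim: A => [|A IHA]; first by rewrite mul0n !big_ord0.
rewrite big_ord_recr /= -IHA -(big_mkord xpredT F) mulSn addnC.
rewrite (@big_cat_nat _ _ _ (A * N)) ?leq_addr //= big_mkord; congr (_ + _).
by rewrite -{1}[(A * N)%N]add0n big_addn addKn big_mkord;
  apply: eq_bigr => j _; rewrite addnC.
Qed.

(* In a relation between q and ys modulo P the part free of q vanishes modulo Q,
   hence has zero coefficients; the rest can be divided by q since P is prime. *)
Lemma alg_indep_cons P Q ys q : prime_ideal P -> is_ideal Q ->
  (forall p, P p -> Q p) -> Q q -> ~ P q -> alg_indep Q ys -> alg_indep P (q :: ys).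
Proof.
move=> [idP _ primeP] idQ PQ Qq NPq indQ N c.
set A := (N ^ size ys)%N.
rewrite [size (q :: ys)]/= expnS (sum_digits N A (fun k => c k *: digit_mon N (q :: ys) k)) => Pc k lt_k.
have N0 : (0 < N)%N by case: (N) lt_k.
suff gen m (d : nat -> nat -> K) :
    P (\sum_(j < m) q ^+ j * \sum_(k < A) d j k *: digit_mon N ys k) ->
    forall j k, (j < m)%N -> (k < A)%N -> d j k = 0.
  rewrite (divn_eq k N); apply: (gen N (fun j k => c (k * N + j)%N)).
  - congr P: Pc; apply: eq_bigr => j _; rewrite mulr_sumr; apply: eq_bigr => i _ /=.
    by rewrite modnMDl modn_small // divnMDl // divn_small // addn0 scalerAr.
  - by rewrite ltn_mod.
  by rewrite ltn_divLR // mulnC.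
elim: m d => // m IHm d.
rewrite big_ord_recl expr0 mul1r.
rewrite (eq_bigr (fun j : 'I_m => q * (q ^+ j * \sum_(k < A) d j.+1 k *: digit_mon N ys k))).
  rewrite -mulr_sumr; set G0 := \sum_(k < A) _; set R := \sum_(j < m) _ => PG.
  have d0 : forall k, (k < A)%N -> d 0%N k = 0.
    apply: indQ; rewrite -[X in Q X](addrK (q * R)).
    by apply: (idealB idQ); [apply: PQ|apply: (idealMC idQ)].
  have G00 : G0 = 0 by rewrite /G0 big1 // => i _; rewrite d0 // scale0r.
  rewrite G00 add0r in PG; case/primeP: PG => // /(IHm (fun j => d j.+1)) h [|j] i; first by move=> _; apply: d0.
  by rewrite ltnS; apply: h.
by move=> j _; rewrite /= /bump /= add1n exprS mulrA.
Qed.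

(** Going down the chain, each strict inclusion contributes an element of the larger prime outside
    the smaller one. *)
Lemma alg_indep_chain P h ys : prime_chain_to P h -> alg_indep P ys ->
  exists P0 zs, [/\ prime_ideal P0, alg_indep P0 zs & size zs = (size ys + h)%N].
Proof.
move=> [c [cprime cstep cP]] indP.
suff gen k : (k <= h)%N -> exists zs, alg_indep (c (h - k)%N) zs /\ size zs = (size ys + k)%N.
  have [zs [ind sz]] := gen h (leqnn h); exists (c 0%N), zs; split=> //.
    exact: cprime.
  by rewrite subnn in ind.
elim: k => [_|k IHk kh].
  exists ys; split; last by rewrite addn0.
  by rewrite subn0 => N d /cP; apply: indP.
have [zs [ind sz]] := IHk (ltnW kh).
have hk : (h - k)%N = (h - k.+1).+1 by lia.
have [sub [q [Qq NPq]]] : (forall p, c (h - k.+1)%N p -> c (h - k)%N p) /\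
    exists p, c (h - k)%N p /\ ~ c (h - k.+1)%N p.
  by rewrite hk; apply: cstep; lia.
exists (q :: zs); split; last by rewrite /= sz addnS.
apply: (alg_indep_cons _ _ sub Qq NPq ind); first by apply: cprime; lia.
by have [] := cprime _ (leq_subr k h).
Qed.

Lemma msize_digit_mon D N ys k : (0 < N)%N -> all (fun y => (msize y <= D.+1)%N) ys ->
  (msize (digit_mon N ys k) <= (size ys * (N * D)).+1)%N.
Proof.
have msize_le d e (p q : S) : (msize p <= d.+1)%N -> (msize q <= e.+1)%N ->
    (msize (p * q) <= (d + e).+1)%N.
  case: (eqVneq p 0) => [->|p0]; first by rewrite mul0r msize0.
  case: (eqVneq q 0) => [->|q0]; first by rewrite mulr0 msize0.
  by rewrite msizeM // => pd qe; rewrite -subn1 leq_subLR (leq_trans (leq_add pd qe)) // addSn addnS.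
move=> N0; elim: ys k => [|y ys IHys] k; first by rewrite /= msize1.
case/andP=> yD ysD; rewrite /= mulSn; apply: (msize_le); last exact: IHys.
apply: (@leq_trans ((k %% N) * D).+1); last first.
  by rewrite ltnS leq_mul2r ltnW ?orbT // ltn_mod.
elim: (k %% N)%N => [|e IHe]; first by rewrite expr0 msize1.
rewrite exprS mulSn.
exact: msize_le.
Qed.

(** With more than n elements, the N^s monomials in them outnumber the monomials in n variables of
    comparable degree, so a linear relation exists. *)
Lemma alg_indep_size P ys : is_ideal P -> alg_indep P ys -> (size ys <= n)%N.
Proof.
move=> idP ind; rewrite leqNgt; apply/negP => n_lt.
pose s := size ys; pose D := (\max_(y <- ys) msize y)%N.
(* All these monomials have degree below L, and L <= C * N. Thus L^n <= C^n * N^n < N^(n+1) <= N^s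
   by the choice of N. *)
pose C := (s * D).+1; pose N := (C ^ n).+1; pose L := (s * (N * D)).+1.
pose A : 'M[K]_(N ^ s, #|{ffun 'I_n -> 'I_L}|) :=
  \matrix_(k, f) (digit_mon N ys k)@_[multinom nat_of_ord ((enum_val f : {ffun 'I_n -> 'I_L}) i) | i < n].
have cardA : (#|{ffun 'I_n -> 'I_L}| < N ^ s)%N.
  rewrite card_ffun !card_ord; apply: (@leq_trans (N ^ n.+1)); last by rewrite leq_exp2l // ltnS expn_gt0.
  rewrite expnS {2}/N; apply: (@leq_ltn_trans ((C * N) ^ n)).
    by case: (n) => // m; rewrite leq_exp2r // /L /C mulSn; nia.
  by rewrite expnMn ltn_pmul2r // expn_gt0.
have : kermx A != 0.
  by rewrite kermx_eq0 /row_free; have := rank_leq_col A; case: eqP => // ->; lia.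
rewrite -nz_row_eq0; set v := nz_row _ => v0.
have vA : v *m A = 0 by apply/sub_kermxP; apply: nz_row_sub.
case/eqP: v0; apply/rowP => k; rewrite mxE.
pose c k := if insub k is Some i then v 0 i else 0.
have cE (i : 'I_(N ^ s)) : c i = v 0 i by rewrite /c valK.
rewrite -cE; apply: (ind N c) => //.
rewrite (_ : \sum_(i < _) _ = 0); first exact: (ideal0 idP).
apply/mpolyP => m; rewrite raddf_sum mcoeff0 /=.
have ysD : all (fun y => (msize y <= D.+1)%N) ys.
  by apply/allP => y yys; apply/leqW/leq_bigmax_seq.
case: (ltnP (mdeg m) L) => mL; last first.
  rewrite big1 // => i _; rewrite mcoeffZ memN_msupp_eq0 ?mulr0 //.
  by apply: msize_mdeg_ge; apply: leq_trans mL; apply: msize_digit_mon.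
have mi i : (m i < L)%N by apply: leq_ltn_trans mL; rewrite mdegE (bigD1 i) //= leq_addr.
move/matrixP: vA => /(_ 0 (enum_rank [ffun i => Ordinal (mi i)])).
rewrite !mxE => vA; rewrite -[RHS]vA; apply: eq_bigr => i _.
rewrite mcoeffZ cE mxE enum_rankK; congr (_ * mcoeff _ _).
by apply/mnmP => j; rewrite mnmE ffunE.
Qed.
End TranscendenceDegree.

(** For the upper bound x_0 is already independent modulo I_H, so a chain of length h yields 1 + h
    independent elements in n + 1 variables. *)
Lemma height_IH (K : fieldType) n (a : 'I_n.+1 -> nat) :
  (forall i, (0 < a i)%N) -> height_is (@IH K _ a) n.
Proof.
move=> a0; split=> [|h chain]; first exact: IH_prime_chain.
have [|P0 [zs [[idP _ _] ind sz]]] := alg_indep_chain (ys := [:: 'X_ord0]) chain.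
  move=> N c Ic k kN; rewrite expn1 in Ic kN.
  move/(congr1 (coefp (k * a ord0))): Ic; rewrite evalHE /= coef0 linear_sum coef_sum.
  rewrite (bigD1 (Ordinal kN)) //= big1 ?addr0 => [|j jk];
    rewrite linearZ /= mulr1 modn_small // mpolyXn linextX wtMn wtU coefZ coefXn.
    by rewrite mulnC eqxx mulr1.
  rewrite mulnC eqn_pmul2l //; case: eqP => [e|_]; last by rewrite mulr0.
  by rewrite -val_eqE /= -e eqxx in jk.
by have := alg_indep_size idP ind; rewrite sz add1n ltnS.
Qed.

(** * Complete intersections defined by squares *)

Section WeightSums.
Variables (K : fieldType) (n : nat) (a : 'I_n -> nat).
Implicit Types f p : {mpoly K[n]}.

Lemma coef_linext_wt (P : pred 'X_{1..n}) p h :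
  (linext (fun m => if P m then 'X^(wt a m) else 0 : {poly K}) p)`_h =
  \sum_(m <- msupp p | P m && (wt a m == h)) p@_m.
Proof.
rewrite /linext coef_sum [RHS]big_mkcond; apply: eq_bigr => m _ /=.
rewrite coefZ; case: (P m); rewrite ?coef0 ?mulr0 //= coefXn eq_sym.
by case: eqP => _; rewrite ?mulr1 ?mulr0.
Qed.

(** A map depending only on the weight sees a polynomial only through its coefficient sums over
    equal weights. *)
Lemma linext_wt_eq0 (P : pred 'X_{1..n}) (V : lmodType K) (psi : nat -> V) p :
  (forall h, \sum_(m <- msupp p | P m && (wt a m == h)) p@_m = 0) ->
  linext (fun m => if P m then psi (wt a m) else 0) p = 0.
Proof.
move=> p0; rewrite /linext; pose B := (\max_(m <- msupp p) wt a m).+1.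
transitivity (\sum_(h < B) (\sum_(m <- msupp p | P m && (wt a m == h)) p@_m) *: psi h); last first.
  by rewrite big1 // => h _; rewrite p0 scale0r.
under [RHS]eq_bigr => h _ do rewrite scaler_suml big_mkcond /=.
rewrite exchange_big /=; apply: eq_big_seq => m mp.
case: (P m) => /=; last by rewrite scaler0 big1.
have lt_mB : (wt a m < B)%N by rewrite ltnS; apply: leq_bigmax_seq.
rewrite (bigD1 (Ordinal lt_mB)) //= eqxx big1 ?addr0 // => h /negbTE hm.
by rewrite eq_sym -[wt a m]/(val (Ordinal lt_mB)) val_eqE hm.
Qed.

Lemma IH_linext0 (V : lmodType K) (psi : nat -> V) f :
  IH a f -> linext (fun m => psi (wt a m)) f = 0.
Proof. by move=> /IHP; apply: (@linext_wt_eq0 predT). Qed.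
End WeightSums.

Section FourGenerators.
Variables t x y z : 'I_4.
Hypothesis idx_uniq : uniq [:: t; x; y; z].

Lemma idx_cover i : [\/ i = t, i = x, i = y | i = z].
Proof.
have : i \in [:: t; x; y; z].
  have /(uniq_min_size idx_uniq) h : {subset [:: t; x; y; z] <= enum 'I_4} by move=> j; rewrite mem_enum.
  by have [|_ ->] := h; rewrite ?size_enum_ord // mem_enum.
by rewrite !inE => /or4P[] /eqP ->; [constructor 1|constructor 2|constructor 3|constructor 4].
Qed.

Lemma idx_sum (F : 'I_4 -> nat) : (\sum_i F i = F t + F x + F y + F z)%N.
Proof.
rewrite (perm_big [:: t; x; y; z]) /=; last first.
  apply: uniq_perm => //; first exact: index_enum_uniq.
  move=> i; rewrite mem_index_enum !inE; symmetry.
  by case: (idx_cover i) => ->; rewrite eqxx ?orbT.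
by rewrite !big_cons big_nil addn0 !addnA.
Qed.

Lemma wt4 a (m : 'X_{1..4}) :
  wt a m = (m t * a t + m x * a x + m y * a y + m z * a z)%N.
Proof. exact: idx_sum. Qed.

Lemma mnm4P (m m' : 'X_{1..4}) :
  m t = m' t -> m x = m' x -> m y = m' y -> m z = m' z -> m = m'.
Proof. by move=> *; apply/mnmP => i; case: (idx_cover i) => ->. Qed.

Lemma idx_neq : [/\ t != x, t != y, t != z & [/\ x != y, x != z & y != z]].
Proof.
by move: idx_uniq; rewrite /= !inE !negb_or => /and4P[/and3P[-> -> ->] /andP[-> ->] -> _].
Qed.

Section SquaresGenerate.
Variables (K : fieldType) (a : 'I_4 -> nat) (mx my mz : 'X_{1..4}).
Hypothesis a_gt0 : forall i, (0 < a i)%N.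
Hypothesis a_lone : forall i m, wt a m = a i -> m = U_(i)%MM.
Hypothesis wt_mx : wt a mx = (a x * 2)%N.
Hypothesis wt_my : wt a my = (a y * 2)%N.
Hypothesis wt_mz : wt a mz = (a z * 2)%N.
Hypothesis mx_t : (0 < mx t)%N.
Hypothesis mz_t : (0 < mz t)%N.
Hypothesis my_t : (0 < my t)%N \/ my = (U_(x) + U_(z))%MM.

Definition canonical (m : 'X_{1..4}) := [&& m x <= 1, m y <= 1 & m z <= 1]%N.

Hypothesis canonical_inj : forall m m', canonical m -> canonical m' ->
  wt a m = wt a m' -> m = m'.

Definition square_gen (i : 'I_3) : {mpoly K[4]} :=
  nth 0 [:: 'X_[U_(x) *+ 2] - 'X_[mx]; 'X_[U_(y) *+ 2] - 'X_[my];
            'X_[U_(z) *+ 2] - 'X_[mz]] i.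

Let I (p : {mpoly K[4]}) := in_ideal (fun q => exists i, q = square_gen i) p.

Let idI : is_ideal I := in_ideal_is_ideal _.

Lemma square_gen_IH p : I p -> IH a p.
Proof.
apply: in_ideal_min; first exact: IH_is_ideal.
move=> q [i ->]; case: i => -[|[|[|//]]] ? /=; apply: IH_binomial;
  by rewrite wtMn wtU.
Qed.

Let sqE (i : 'I_4) (m : 'X_{1..4}) :
  (2 <= m i)%N -> (U_(i) *+ 2 + (m - U_(i) *+ 2))%MM = m.
Proof.
move=> mi; rewrite addmC submK //; apply/mnm_lepP => j.
by rewrite mulmnE mnm1E; case: eqP => [<-|]; rewrite ?mul1n ?mul0n.
Qed.

(** Induction on the weight: once a rewriting step brings in t, cancelling t lowers the weight, and
    putting t back keeps a monomial canonical. *)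
Lemma square_canonical m : exists v,
  [/\ canonical v, wt a v = wt a m & I ('X_[m] - 'X_[v])].
Proof.
have [w] := ubnP (wt a m); elim: w m => // w IHw m; rewrite ltnS => mw.
have Itrans m1 m2 m3 : I ('X_[m1] - 'X_[m2]) -> I ('X_[m2] - 'X_[m3]) -> I ('X_[m1] - 'X_[m3]).
  by move=> /(idealD idI)/[apply]; rewrite addrA subrK.
have Imul m0 m1 m2 : I ('X_[m1] - 'X_[m2]) -> I ('X_[m1 + m0] - 'X_[m2 + m0]).
  by rewrite !mpolyXD -mulrBl; apply: (idealMC idI).
pose good u := exists v, [/\ canonical v, wt a v = wt a u & I ('X_[u] - 'X_[v])].
have step u u' : wt a u = wt a u' -> I ('X_[u] - 'X_[u']) -> good u' -> good u.
  move=> e Iu [v [cv wv Iv]]; exists v; split=> //; first by rewrite e.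
  exact: Itrans Iu Iv.
have goodt (u : 'X_{1..4}) : (wt a u <= w)%N -> (0 < u t)%N -> good u.
  move=> uw ut; have le_tu : (U_(t) <= u)%MM by rewrite lep1mP -lt0n.
  have := submK le_tu; set u' := (u - _)%MM => uE.
  have [|v [cv wv Iv]] := IHw u'.
    by rewrite -uE wtD wtU in uw; have := a_gt0 t; lia.
  have [/negbTE tx /negbTE ty /negbTE tz _] := idx_neq.
  exists (v + U_(t))%MM; split.
  - by rewrite /canonical !mnmDE !mnm1E tx ty tz !addn0.
  - by rewrite -[in RHS]uE !wtD wv.
  by rewrite -uE; apply: Imul.
have gen_I (i : 'I_3) : I (square_gen i) by apply: in_idealW; exists i.
have goodsq i mi (u : 'X_{1..4}) : wt a mi = (a i * 2)%N -> I ('X_[U_(i) *+ 2] - 'X_[mi]) ->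
    (2 <= u i)%N -> good (mi + (u - U_(i) *+ 2))%MM -> good u.
  move=> wi Ii /sqE ui; apply: (step _ (mi + (u - U_(i) *+ 2))%MM).
    by rewrite -[in LHS]ui wtD wtMn wtU wtD wi.
  by rewrite -[in X in I (X - _)]ui; apply: Imul.
have wsq i mi (u : 'X_{1..4}) : wt a mi = (a i * 2)%N -> (2 <= u i)%N ->
    wt a (mi + (u - U_(i) *+ 2))%MM = wt a u.
  by move=> wi /sqE ui; rewrite -[in RHS]ui [RHS]wtD wtMn wtU wtD wi.
have goodx (u : 'X_{1..4}) : (wt a u <= w)%N -> (2 <= u x)%N -> good u.
  move=> uw ux; apply: (goodsq x mx) => //; first exact: (gen_I 0).
  by apply: goodt; rewrite ?wsq // mnmDE addn_gt0 mx_t.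
have goodz (u : 'X_{1..4}) : (wt a u <= w)%N -> (2 <= u z)%N -> good u.
  move=> uw uz; apply: (goodsq z mz) => //; first exact: (gen_I 2).
  by apply: goodt; rewrite ?wsq // mnmDE addn_gt0 mz_t.
case: (ltnP 1 (m x)) => [|mx1]; first exact: goodx.
case: (ltnP 1 (m z)) => [|mz1]; first exact: goodz.
case: (ltnP 1 (m y)) => [my2|my1]; last first.
  by exists m; split=> //; [apply/and3P|rewrite subrr; apply: (ideal0 idI)].
have Iy : I ('X_[U_(y) *+ 2] - 'X_[my]) := gen_I 1.
have [/negbTE tx /negbTE ty /negbTE tz [/negbTE xy /negbTE xz /negbTE yz]] := idx_neq.
have [myt|myE] := my_t.
  apply: (goodsq y my) => //.
  by apply: goodt; rewrite ?wsq // mnmDE addn_gt0 myt.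
(* Here y^2 becomes xz, which brings in no t. If x or z is present, an x^2 or z^2 arises and does;
   from y^4 on, a first exchange makes x and z present; y^2 and y^3 become canonical at once. *)
have goody (u : 'X_{1..4}) : (wt a u <= w)%N -> (2 <= u y)%N -> (0 < u x + u z)%N -> good u.
  move=> uw uy uxz; apply: (goodsq y my) => //.
  have [ux|ux] := posnP (u x).
    apply: goodz; first by rewrite wsq.
    by rewrite myE !mnmDE !mnmBE !mulmnE !mnm1E yz xz eqxx; lia.
  apply: goodx; first by rewrite wsq.
  by rewrite myE !mnmDE !mnmBE !mulmnE !mnm1E (eq_sym z) (eq_sym y) xy xz eqxx; lia.
case: (ltnP 3 (m y)) => my4.
  apply: (goodsq y my) => //; apply: goody; first by rewrite wsq.
    by rewrite myE !mnmDE !mnmBE !mulmnE !mnm1E xy (eq_sym z) yz eqxx; lia.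
  by rewrite myE !mnmDE !mnmBE !mulmnE !mnm1E (eq_sym z) (eq_sym y) xy xz eqxx; lia.
case: (posnP (m x + m z)) => mxz; last exact: goody.
apply: (goodsq y my) => //; set u := (_ + _)%MM; exists u.
split=> //; last by rewrite subrr; apply: (ideal0 idI).
rewrite /canonical /u myE !mnmDE !mnmBE !mulmnE !mnm1E !eqxx (eq_sym z) (eq_sym y) xy xz yz.
rewrite [z == y]eq_sym yz; lia.
Qed.

(** By [canonical_inj] the normal form [V] depends on the weight only. For p in I_H the sum of the
    normal forms of its terms is therefore 0, and p is a combination of differences of a monomial
    and its normal form. *)
Lemma square_gen_generates p : IH a p <-> I p.
Proof.
split; last exact: square_gen_IH.
move=> Ip.
have [V VP] : exists V : nat -> 'X_{1..4}, forall m, I ('X_[m] - 'X_[V (wt a m)]).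
  pose V h := epsilon (inhabits 0%MM) (fun v => canonical v /\ wt a v = h).
  exists V => m; have [v [cv wv Iv]] := square_canonical m.
  have [cV wV] : canonical (V (wt a m)) /\ wt a (V (wt a m)) = wt a m.
    by apply: (epsilon_spec (inhabits 0%MM) (fun v => canonical v /\ wt a v = wt a m)); exists v.
  by rewrite (canonical_inj cV cv) // wV wv.
have := IH_linext0 (fun h => 'X_[V h] : {mpoly K[4]}) Ip.
rewrite /linext => e0; rewrite -(subr0 p) -e0 {1}(mpolyE p) -sumrB.
by apply: (ideal_sum idI) => m _; rewrite -scalerBr; apply: (idealZ idI).
Qed.

Definition square_coefs (p : {mpoly K[4]}) : 'rV[K]_3 :=
  \row_i p@_(U_(nth t [:: x; y; z] i) *+ 2)%MM.

Lemma mcoeff_sqM (r p : {mpoly K[4]}) i :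
  p@_0%MM = 0 -> (forall j, p@_U_(j) = 0) ->
  (r * p)@_(U_(i) *+ 2)%MM = r@_0%MM * p@_(U_(i) *+ 2)%MM.
Proof.
move=> p0 p1; rewrite mulrC {1}(mpolyE r) mulr_sumr raddf_sum /=.
transitivity (\sum_(m <- msupp r) (if m == 0%MM then r@_0%MM * p@_(U_(i) *+ 2)%MM else 0)).
  apply: eq_bigr => m _; rewrite -scalerAr mcoeffZ mcoeffMXr.
  case: (eqVneq m 0%MM) => [->|m0]; first by rewrite subm0 (introT mnm_lepP) // => j; rewrite mnm0E.
  case: ifP => [le_m|_]; last by rewrite mulr0.
  have := congr1 mdeg (submK le_m); rewrite mdegD mdegMn mdeg1 => e.
  have m0' : mdeg m != 0%N by rewrite mdeg_eq0.
  case: (posnP (mdeg (U_(i) *+ 2 - m)%MM)) => [/eqP|e'].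
    by rewrite mdeg_eq0 => /eqP ->; rewrite p0 mulr0.
  have /mdeg1P[j /eqP ->] : mdeg (U_(i) *+ 2 - m)%MM == 1%N by lia.
  by rewrite p1 mulr0.
rewrite -big_mkcond /=; case: (boolP (0%MM \in msupp r)) => [r0|/[dup] r0 /memN_msupp_eq0 ->].
  by rewrite -big_filter filter_pred1_uniq // big_seq1.
by rewrite mul0r big1.
Qed.

(** The point is that fewer than three generators cannot do: the coefficients of x^2, y^2, z^2 map
    I_H onto K^3, and the images of any generators span the image. *)
Lemma complete_intersection_of_squares : complete_intersection K a.
Proof.
exists 3%N; split; first exact: height_IH.
split; first by exists square_gen => p; apply: square_gen_generates.
move=> k [g gP].
pose G : 'M[K]_(k, 3) := \matrix_(i, j) square_coefs (g i) 0 j.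
(* An ideal containing every [g i]: without constant and linear terms in p, only the constant term
   of r reaches the square coefficients of [r * p]. *)
pose N (p : {mpoly K[4]}) := [/\ p@_0%MM = 0, forall j, p@_U_(j) = 0 & (square_coefs p <= G)%MS].
have idN : is_ideal N.
  split.
  - split=> *; rewrite ?mcoeff0 //.
    by rewrite (_ : square_coefs 0 = 0) ?sub0mx //; apply/rowP => j; rewrite !mxE mcoeff0.
  - move=> p q [p0 p1 pG] [q0 q1 qG]; split=> *; rewrite ?mcoeffD ?p0 ?p1 ?q0 ?q1 ?addr0 //.
    rewrite (_ : square_coefs _ = square_coefs p + square_coefs q) ?addmx_sub //.
    by apply/rowP => j; rewrite !mxE mcoeffD.
  move=> r p [p0 p1 pG]; split.
  - by rewrite mcoeffM big1 // => -[m1 m2] /= /eqP/esym/eqP;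
      rewrite mnmD_eq0 => /andP[_ /eqP ->]; rewrite p0 mulr0.
  - move=> j; rewrite mcoeffM big1 // => -[m1 m2] /= /eqP e.
    have d : 1%N = (mdeg m1 + mdeg m2)%N by rewrite -mdegD -e mdeg1.
    case: (posnP (mdeg m2)) => [/eqP|d2].
      by rewrite mdeg_eq0 => /eqP ->; rewrite p0 mulr0.
    have /mdeg1P[l /eqP ->] : mdeg m2 == 1%N by lia.
    by rewrite p1 mulr0.
  rewrite (_ : square_coefs _ = r@_0%MM *: square_coefs p) ?scalemx_sub //.
  by apply/rowP => j; rewrite !mxE mcoeff_sqM.
have IHN p : IH a p -> N p.
  move=> /gP; apply: in_ideal_min => // q [i ->].
  have gi : IH a (g i) by apply/gP/in_idealW; exists i.
  split.
  - apply: (IH_lone_coef gi) => m; rewrite wt0 => m0.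
    by apply/eqP; rewrite -mdeg_eq0 -leqn0; apply: leq_trans (mdeg_le_wt m a_gt0) _; rewrite m0.
  - by move=> j; apply: (IH_lone_coef gi) => m; rewrite wtU; apply: a_lone.
  by rewrite (_ : square_coefs _ = row i G) ?row_sub //; apply/rowP => j; rewrite !mxE.
(* Each x_i^2 - m_i gives a unit vector, because m_i contains t or is xz and so is none of the three
   squares. *)
have : (\rank (1%:M : 'M[K]_3) <= \rank G)%N.
  apply: mxrankS; apply/row_subP => i.
  have [_ _] := IHN (square_gen i) (square_gen_IH (in_idealW (ex_intro _ i erefl))).
  congr (_ <= _)%MS; apply/rowP => j; rewrite !mxE.
  have [/negbTE tx /negbTE ty /negbTE tz [/negbTE xy /negbTE xz /negbTE yz]] := idx_neq.
  have U2inj (i1 i2 : 'I_4) : ((U_(i1) *+ 2)%MM == (U_(i2) *+ 2)%MM) = (i1 == i2).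
    apply/eqP/eqP => [e|-> //]; have := congr1 (fun m : 'X_{1..4} => m i1) e.
    by rewrite !mulmnE !mnm1E eqxx; case: eqP.
  have notsq (m : 'X_{1..4}) i1 : t != i1 -> (0 < m t)%N -> (m == (U_(i1) *+ 2)%MM) = false.
    move=> /negbTE ti mt; apply/eqP => e; move: mt.
    by rewrite e mulmnE mnm1E eq_sym ti.
  have notmy (i1 : 'I_4) : t != i1 -> (my == (U_(i1) *+ 2)%MM) = false.
    move=> ti; have [|->] := my_t; first exact: notsq.
    apply/eqP => e; have := congr1 (fun m : 'X_{1..4} => m x) e.
    have := congr1 (fun m : 'X_{1..4} => m z) e.
    rewrite !mulmnE !mnmDE !mnm1E !eqxx xz (eq_sym z) xz.
    by case: eqP => [->|]; rewrite ?xz //= (eq_sym z).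
  case: i j => -[|[|[|//]]] ? [[|[|[|//]]] ?] /=; rewrite /square_gen /= mcoeffB !mcoeffX !U2inj
    ?notmy ?notsq ?eqxx ?tx ?ty ?tz ?xy ?xz ?yz ?(eq_sym y x) ?(eq_sym z x) ?(eq_sym z y)
    ?xy ?xz ?yz ?subr0 //.
by rewrite mxrank1 => /leq_trans -> //; apply: rank_leq_row.
Qed.
End SquaresGenerate.
End FourGenerators.

(** * The tangent cone *)

Section TangentCone.
Variables (K : fieldType) (n : nat) (a : 'I_n -> nat).
Hypothesis a_gt0 : forall i, (0 < a i)%N.
Implicit Types (f p : {mpoly K[n]}) (m : 'X_{1..n}).
Local Notation J := (@IHstar K n a).

Let idJ : is_ideal J := @IHstar_is_ideal K n a.

Lemma IHstar_binomial m m' : wt a m = wt a m' -> (mdeg m <= mdeg m')%N ->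
  J ('X_[m] - if mdeg m == mdeg m' then 'X_[m'] else 0).
Proof.
move=> e le_mm'; have := IHstar_hcomp (K := K) (IH_binomial K e) (d := mdeg m).
have hX l : homogeneous (mdeg l) ('X_[l] : {mpoly K[n]}) by rewrite /homogeneous msuppX /= eqxx.
rewrite hcompB hcomp_id //; case: eqP => [d|/eqP d].
  rewrite (_ : hcomp _ 'X_[m'] = 'X_[m']); last by rewrite d hcomp_id.
  apply=> l lm; rewrite mcoeffB !mcoeffX.
  by case: eqP => [e'|_]; [|case: eqP => [e'|_]]; rewrite ?subr0 //;
    move: lm; rewrite -e' -?d ltnn.
rewrite (hcomp_ne d) // subr0; apply=> l lm; rewrite mcoeffB !mcoeffX.
by case: eqP => [e'|_]; [|case: eqP => [e'|_]]; rewrite ?subr0 //;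
  move: lm; rewrite -e' ltnNge ?leqnn ?le_mm'.
Qed.

(** A monomial has degree at most its weight, so the bounded quantifier ranges over all
    factorizations and the test is boolean. *)
Definition maximal_mon m :=
  [forall m' : 'X_{1..n < (wt a m).+1}, (wt a m' == wt a m) ==> (mdeg m' <= mdeg m)%N].

Lemma maximal_monP m :
  reflect (forall m', wt a m' = wt a m -> (mdeg m' <= mdeg m)%N) (maximal_mon m).
Proof.
apply: (iffP forallP) => [max m' e|max m']; last by apply/implyP => /eqP; apply: max.
have lt_m' : (mdeg m' < (wt a m).+1)%N by rewrite ltnS -e mdeg_le_wt.
by have /implyP := max (BMultinom lt_m'); apply; rewrite /= e.
Qed.

Lemma maximal_mon_ex m : exists m', [/\ wt a m' = wt a m, maximal_mon m' & (mdeg m <= mdeg m')%N].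
Proof.
have [b] := ubnP (wt a m - mdeg m); elim: b m => // b IHb m; rewrite ltnS => mb.
case: (boolP (maximal_mon m)) => [mm|]; first by exists m.
rewrite negb_forall => /existsP[m1]; rewrite negb_imply -ltnNge => /andP[/eqP e lt_m].
have := mdeg_le_wt m1 a_gt0; rewrite e => le1.
have [|m' [e' max' le']] := IHb m1; first by rewrite e; lia.
by exists m'; split; rewrite ?e' //; apply: leq_trans le'; apply: ltnW.
Qed.

(* The tangent cone has a basis indexed by the elements of H, a monomial being
   nonzero in it exactly when it is a longest factorization; symbol is the
   quotient map. *)
Definition symbol p := linext (fun m => if maximal_mon m then 'X^(wt a m) else 0 : {poly K}) p.

(** Let f in I_H have lowest degree d. If a longest factorization of h has length d, every term of f
    of weight h has degree d, and their coefficients sum to 0; otherwise weight h contributes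
    nothing. Conversely, modulo J a monomial that is not longest vanishes, and two longest ones of
    the same weight agree. *)
Lemma IHstar_symbol p : J p <-> symbol p = 0.
Proof.
split.
  move: p; apply: IHstar_ind => [|p q p0 q0|c p p0|d f If f0].
  - exact: linear0.
  - by rewrite /symbol linearD /= [linext _ p]p0 [linext _ q]q0 addr0.
  - by rewrite /symbol linearZ /= [linext _ p]p0 scaler0.
  rewrite /symbol /hcomp linear_sum /=; apply/polyP => h; rewrite coef0 coef_sum.
  rewrite (eq_bigr (fun m => if maximal_mon m && (wt a m == h) then f@_m else 0)); last first.
    move=> m _; rewrite linearZ /= linextX coefZ; case: ifP => _; rewrite ?coef0 ?mulr0 //=.
    by rewrite coefXn eq_sym; case: eqP => _; rewrite ?mulr1 ?mulr0.
  rewrite -big_mkcondr /=.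
  case: (boolP (has (fun m => [&& mdeg m == d, maximal_mon m & wt a m == h]) (msupp f))); last first.
    by move=> /hasPn no; rewrite big1_seq // => m /andP[Pm /no]; rewrite Pm.
  move=> /hasP[m0 _ /and3P[/eqP d0 max0 /eqP h0]].
  move/IHP: If => /(_ h) If; rewrite -[RHS]If big_seq_cond [RHS]big_seq_cond.
  apply: eq_bigl => m; case mf: (m \in msupp f) => //=.
  case: (wt a m =P h) => [hm|]; rewrite ?andbF // andbT.
  have dm : mdeg m = d.
    apply/eqP; rewrite eqn_leq -{1}d0 (maximal_monP _ max0) ?h0 //= leqNgt.
    by apply: contraTN mf => /f0 fm; rewrite mcoeff_msupp fm eqxx.
  rewrite dm eqxx /=; apply/maximal_monP => m' e.
  by rewrite dm -d0; apply: (maximal_monP _ max0); rewrite e h0.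
move=> p0; pose V h := epsilon (inhabits 0%MM) (fun v => maximal_mon v /\ wt a v = h).
have VP m : maximal_mon (V (wt a m)) /\ wt a (V (wt a m)) = wt a m.
  apply: (epsilon_spec (inhabits 0%MM) (fun v => maximal_mon v /\ wt a v = wt a m)).
  by have [v [e max _]] := maximal_mon_ex m; exists v.
have e0 : linext (fun m => if maximal_mon m then 'X_[V (wt a m)] else 0 : {mpoly K[n]}) p = 0.
  apply: (@linext_wt_eq0 _ _ _ maximal_mon _ (fun h => 'X_[V h] : {mpoly K[n]})) => h.
  by rewrite -coef_linext_wt [linext _ p]p0 coef0.
rewrite -(subr0 p) -e0 {1}(mpolyE p) /linext -sumrB.
apply: (ideal_sum idJ) => m _; rewrite -scalerBr; apply: (idealZ idJ).
have [maxV wV] := VP m; case: (boolP (maximal_mon m)) => [max|nmax].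
  have dV : mdeg m = mdeg (V (wt a m)).
    apply/eqP; rewrite eqn_leq (maximal_monP _ maxV) //.
    by rewrite (maximal_monP _ max).
  by have := IHstar_binomial (esym wV); rewrite dV eqxx leqnn; apply.
have [v [e max le]] := maximal_mon_ex m; have := IHstar_binomial (esym e) le.
case: eqP => // d; case/negP: nmax; apply/maximal_monP => m' e'.
by rewrite d; apply: (maximal_monP _ max); rewrite e' e.
Qed.

(* The hypothesis says that the tangent cone is Cohen-Macaulay: a factorization
   of an element of H + a t may be chosen of maximal length and using a t. *)
Lemma IHstar_nonzerodivisor t p :
  (forall m m', wt a m = wt a (m' + U_(t))%MM ->
     exists u, [/\ wt a u = wt a m, (mdeg m <= mdeg u)%N & (0 < u t)%N]) ->
  J (p * 'X_t) -> J p.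
Proof.
(* Adding t then keeps a factorization longest, so multiplication by x_t becomes multiplication by
   X^(a t) on symbols. *)
move=> CM; have max_t m : maximal_mon (m + U_(t))%MM = maximal_mon m.
  apply/maximal_monP/maximal_monP => max m' e.
    have := max (m' + U_(t))%MM; rewrite !wtD e => /(_ erefl).
    by rewrite !mdegD leq_add2r.
  have [u [eu le_u ut]] := CM _ _ e; apply: leq_trans le_u _.
  have le_tu : (U_(t) <= u)%MM by rewrite lep1mP -lt0n.
  rewrite -(submK le_tu) !mdegD leq_add2r; apply: max.
  have : wt a (u - U_(t) + U_(t))%MM = wt a (m + U_(t))%MM by rewrite submK // eu e.
  by rewrite !wtD => /addIn.
rewrite !IHstar_symbol => pt0; suff : 'X^(a t) * symbol p = 0.
  by move/eqP; rewrite mulf_eq0 expf_eq0 polyX_eq0 andbF => /eqP.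
rewrite -pt0 /symbol {2}(mpolyE p) mulr_suml linear_sum {1}/linext mulr_sumr.
apply: eq_bigr => m _; rewrite -scalerAl linearZ /= -mpolyXD linextX max_t -scalerAr.
by case: ifP => _; rewrite ?mulr0 // wtD wtU exprD mulrC.
Qed.
End TangentCone.

(** * Minimal generators and Apery sets *)

Lemma in_genD S h h' : in_gen S h -> in_gen S h' -> in_gen S (h + h').
Proof. by move=> Sh Sh'; elim: Sh => // u v Su _ IH; rewrite -addnA; constructor. Qed.

Lemma in_gen_sub S S' h : (forall u, S u -> in_gen S' u) -> in_gen S h -> in_gen S' h.
Proof. by move=> SS'; elim=> [|u v /SS' Su _]; [constructor|apply: in_genD]. Qed.

Lemma in_genW (S : nat -> Prop) u : S u -> in_gen S u.
Proof. by move=> Su; rewrite -(addn0 u); do 2?constructor. Qed.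

Section MinGens.
Variables (H : nat -> Prop) (n : nat) (a : 'I_n -> nat).
Hypothesis minG : min_gen_set H a.

Lemma sg_wt h : H h <-> exists m, wt a m = h.
Proof.
have [_ -> _] := minG; split.
  elim=> [|_ v [i <-] _ [m <-]]; first by exists 0%MM; rewrite wt0.
  by exists (U_(i) + m)%MM; rewrite wtD wtU.
move=> [m <-]; rewrite /wt; elim/big_ind: _ => [|u v|i _]; [constructor|exact: in_genD|].
by elim: (m i) => [|k IHk]; [constructor|rewrite mulSn; constructor => //; exists i].
Qed.

Lemma sgW m : H (wt a m).
Proof. by apply/sg_wt; exists m. Qed.

(** A factorization of [a i] avoiding i would make the generator [a i] redundant. *)
Lemma gen_not_others i (m : 'X_{1..n}) : m i = 0%N -> wt a m <> a i.
Proof.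
move=> mi0 mE; have [_ HE nmin] := minG; apply: (nmin i) => h; rewrite HE; split.
  apply: in_gen_sub => _ [j <-]; case: (eqVneq j i) => [->|ji]; last first.
    by apply: in_genW; exists j.
  rewrite -mE /wt; elim/big_ind: _ => [|u v|l _]; [constructor|exact: in_genD|].
  case: (eqVneq l i) => [->|li]; first by rewrite mi0; constructor.
  by elim: (m l) => [|k IHk]; [constructor|rewrite mulSn; constructor => //; exists l].
by apply: in_gen_sub => _ [j _ <-]; apply: in_genW; exists j.
Qed.

Lemma gen_gt0 i : (0 < a i)%N.
Proof.
by rewrite lt0n; apply/eqP => ai0; apply: (@gen_not_others i 0%MM); rewrite ?mnm0E ?wt0.
Qed.

Lemma gen_lone i (m : 'X_{1..n}) : wt a m = a i -> m = U_(i)%MM.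
Proof.
move=> mE; have [/gen_not_others//|mi] := posnP (m i).
have le_im : (U_(i) <= m)%MM by rewrite lep1mP -lt0n.
have := submK le_im => e; move: mE; rewrite -{1}e wtD wtU.
rewrite -[RHS]add0n => /addIn w0; rewrite -e.
suff -> : (m - U_(i))%MM = 0%MM by rewrite add0m.
by apply/eqP; rewrite -mdeg_eq0 -leqn0; apply: leq_trans (mdeg_le_wt _ gen_gt0) _; rewrite w0.
Qed.

Lemma sg0 : H 0%N. Proof. by rewrite -(wt0 a); apply: sgW. Qed.

Lemma sg_gen i : H (a i). Proof. by rewrite -(wtU a); apply: sgW. Qed.

Lemma sgD h h' : H h -> H h' -> H (h + h')%N.
Proof. by move=> /sg_wt[m <-] /sg_wt[m' <-]; rewrite -wtD; apply: sgW. Qed.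

Lemma sgM k h : H h -> H (k * h)%N.
Proof. by move=> Hh; elim: k => [|k IHk]; [exact: sg0|rewrite mulSn; apply: sgD]. Qed.

Lemma gen_split i h h' : H h -> H h' -> (h + h')%N = a i -> h = 0%N \/ h' = 0%N.
Proof.
move=> /sg_wt[m <-] /sg_wt[m' <-]; rewrite -wtD => /gen_lone e.
have : mdeg (m + m')%MM = 1%N by rewrite e mdeg1.
rewrite mdegD => d; case: (posnP (mdeg m)) => [/eqP|d'].
  by rewrite mdeg_eq0 => /eqP ->; left; rewrite wt0.
have /eqP : mdeg m' = 0%N by lia.
by rewrite mdeg_eq0 => /eqP ->; right; rewrite wt0.
Qed.

Lemma gen_subD i j h : i != j -> H h -> (a j + h)%N <> a i.
Proof.
move=> ij Hh e; have [] := gen_split (sg_gen j) Hh e; have := gen_gt0 j.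
  by move=> + a0; rewrite a0.
move=> _ h0; move: e ij; rewrite h0 addn0 => e.
by have [inj _ _] := minG; rewrite (inj _ _ e) eqxx.
Qed.

Section Apery.
Variable t : 'I_n.

(** The condition that h - a t is not in H, written additively to avoid truncated subtraction. *)
Definition apery h := H h /\ forall h', H h' -> (h' + a t)%N <> h.

Lemma apery_divisor h h' : H h -> H h' -> apery (h + h') -> apery h.
Proof.
move=> Hh Hh' [_ ap]; split=> // u Hu e; apply: (ap (u + h')%N); first exact: sgD.
by rewrite -e addnAC.
Qed.

Lemma apery_gen i : i != t -> apery (a i).
Proof.
move=> it; split=> [|h Hh]; first exact: sg_gen.
by rewrite addnC; apply: gen_subD.
Qed.

Lemma apery0 : apery 0.
Proof. by split=> [|h _]; [exact: sg0|have := gen_gt0 t; lia]. Qed.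

Lemma apery_mod h h' : apery h -> apery h' -> h = h' %[mod a t] -> h = h'.
Proof.
wlog: h h' / (h <= h')%N => [W|le_hh'] Ah Ah' e.
  by case/orP: (leq_total h h') => l; [|symmetry]; apply: W.
case: (Ah) (Ah') => Hh _ [_ ap].
have /dvdnP[[|k] kE] : (a t %| h' - h)%N by rewrite -eqn_mod_dvd // e.
  by lia.
case: (ap (h + k * a t)%N); first by apply/sgD/sgM/sg_gen.
by move: kE; rewrite mulSn; lia.
Qed.

Hypothesis numH : numerical_semigroup H.

Lemma apery_residue r : exists2 h, apery h & h = r %[mod a t].
Proof.
have [_ _ [N HN]] := numH.
have : H (N * a t + r)%N by apply: HN; have := gen_gt0 t; nia.
have : (N * a t + r)%N = r %[mod a t] by rewrite modnMDl.
move: (_ + r)%N => h; have [b] := ubnP h; elim: b h => // b IHb h; rewrite ltnS => hb hr Hh.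
case: (classic (apery h)) => [Ah|nA]; first by exists h.
have [u Hu uE] : exists2 u, H u & (u + a t)%N = h.
  by apply: NNPP => nu; apply: nA; split=> // u Hu uE; apply: nu; exists u.
apply: (IHb u) => //; first by have := gen_gt0 t; lia.
by rewrite -hr -uE modnDr.
Qed.

Hypothesis symH : symmetric_sg H.

(** Take w = g(H) + a t. For h in the Apery set h - a t is not in H, so by symmetry g(H) - (h - a t)
    = w - h is. *)
Lemma symmetric_apery : exists2 w, apery w &
  forall h, apery h -> exists2 h', H h' & (h + h')%N = w.
Proof.
have [g [[NHg Hg] sym]] := symH; exists (g + a t)%N.
  split=> [|h Hh /addIn e]; last by rewrite -e in NHg.
  by apply: Hg; have := gen_gt0 t; lia.
move=> h [Hh ap]; have := sym (Posz h - Posz (a t)).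
case: (classic (inH H (Posz g - (Posz h - Posz (a t))))) => [+ _|N1 N2].
  case eq_u: (_ - _) => [u|//] /= Hu; exists u => //; lia.
exfalso; apply: N2; split=> // I2; exfalso; move: I2.
case eq_u: (_ - _) => [u|//] /= Hu; apply: (ap u) => //; lia.
Qed.
End Apery.
End MinGens.

(** * Symmetric semigroups with four generators *)

Local Open Scope nat_scope.

Lemma idx_complete (t : 'I_4) : exists x y z, uniq [:: t; x; y; z].
Proof.
have e : perm_eq (enum 'I_4) (t :: rem t (enum 'I_4)).
  by apply: perm_to_rem; rewrite mem_enum.
have := enum_uniq 'I_4; rewrite (perm_uniq e) => u.
have := perm_size e; rewrite size_enum_ord.
by case: (rem _ _) u => [|x [|y [|z [|? ?]]]] // u _; exists x, y, z.
Qed.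

Lemma idx_sorted (a : 'I_4 -> nat) : injective a ->
  exists t x y z, [/\ uniq [:: t; x; y; z], a t < a x, a x < a y & a y < a z]%N.
Proof.
move=> inj; pose s := sort (relpre a leq) (enum 'I_4).
have us : uniq s by rewrite sort_uniq enum_uniq.
have : sorted (relpre a leq) s by apply: sort_sorted => u v; apply: leq_total.
have : size s = 4 by rewrite size_sort size_enum_ord.
case: s us => [|t [|x [|y [|z [|? ?]]]]] // us _ /=.
case/and4P=> tx xy yz _; exists t, x, y, z.
have lt i j : i != j -> (a i <= a j)%N -> (a i < a j)%N.
  by move=> ij le; rewrite ltn_neqAle le andbT (inj_eq inj).
have [ntx _ _ [nxy _ nyz]] := idx_neq us.
by split=> //; apply: lt.
Qed.

Section FourGeneratedSymmetric.
Variables (H : nat -> Prop) (a : 'I_4 -> nat).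
Hypothesis minG : min_gen_set H a.
Hypothesis numH : numerical_semigroup H.
Hypothesis symH : symmetric_sg H.

Let inj : injective a. Proof. by case: minG. Qed.

Section Labelled.
Variables t x y z : 'I_4.
Hypothesis idx : uniq [:: t; x; y; z].

(** At least two generators besides [a t] are summands of w; a generator has no other generator as a
    summand. *)
Lemma max_apery_not_gen w :
  (forall h, apery H a t h -> exists2 h', H h' & (h + h')%N = w) ->
  w <> 0%N /\ forall i, i != t -> w <> a i.
Proof.
move=> wP; have [tx ty _ [xy _ _]] := idx_neq idx; split.
  have [h' _] := wP _ (apery_gen minG (i := x) (t := t) ltac:(by rewrite eq_sym)).
  by have := gen_gt0 minG x; lia.
move=> i it e; have [j ji jt] : exists2 j, i != j & j != t.
  by case: (eqVneq i x) => [->|ix]; [exists y|exists x]; rewrite // eq_sym.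
have [h' Hh'] := wP _ (apery_gen minG jt).
by rewrite e; apply: (gen_subD minG).
Qed.

(** 0, w and the three other generators exhaust the residues modulo 5. The complement w - a_i lies
    in the Apery set and is neither 0 nor w, so it is a generator. *)
Lemma five_residues : a t = 5 ->
  [/\ a x %% 5 != 0, a y %% 5 != 0, a z %% 5 != 0,
     [/\ a x %% 5 != a y %% 5, a x %% 5 != a z %% 5 & a y %% 5 != a z %% 5]
   & exists w, apery H a t w /\ [/\ [/\ w %% 5 != 0, w %% 5 != a x %% 5, w %% 5 != a y %% 5 & w %% 5 != a z %% 5],
       w = a x + a x \/ w = a x + a y \/ w = a x + a z,
       w = a y + a x \/ w = a y + a y \/ w = a y + a z
     & w = a z + a x \/ w = a z + a y \/ w = a z + a z]]%N.
Proof.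
move=> t5; have [tx ty tz [xy xz yz]] := idx_neq idx.
have [w Aw wP] := symmetric_apery minG t symH.
have [w0 wgen] := max_apery_not_gen wP.
have mod5 h h' : apery H a t h -> apery H a t h' -> (h %% 5 = h' %% 5)%N -> h = h'.
  by move=> Ah Ah' e; apply: (apery_mod minG Ah Ah'); rewrite t5.
have A0 := apery0 minG t.
have Ag i : i != t -> apery H a t (a i) := @apery_gen _ _ _ minG t i.
have Agen : [/\ apery H a t (a x), apery H a t (a y) & apery H a t (a z)].
  by split; apply: Ag; rewrite eq_sym.
have [Ax Ay Az] := Agen.
have g0 i : a i <> 0%N by have := gen_gt0 minG i; lia.
have nx : a x %% 5 != 0 by apply/eqP => e; apply: (g0 x); apply: mod5.
have ny : a y %% 5 != 0 by apply/eqP => e; apply: (g0 y); apply: mod5.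
have nz : a z %% 5 != 0 by apply/eqP => e; apply: (g0 z); apply: mod5.
have nxy : a x %% 5 != a y %% 5.
  by apply: contraNneq xy => e; apply/eqP/inj/mod5.
have nxz : a x %% 5 != a z %% 5.
  by apply: contraNneq xz => e; apply/eqP/inj/mod5.
have nyz : a y %% 5 != a z %% 5.
  by apply: contraNneq yz => e; apply/eqP/inj/mod5.
have nw : w %% 5 != 0 by apply/eqP => e; apply: w0; apply: mod5.
have nwg i : i != t -> w %% 5 != a i %% 5.
  by move=> it; apply/eqP => e; apply: (wgen i it); apply: mod5 => //; apply: Ag.
have nwx : w %% 5 != a x %% 5 by apply: nwg; rewrite eq_sym.
have nwy : w %% 5 != a y %% 5 by apply: nwg; rewrite eq_sym.
have nwz : w %% 5 != a z %% 5 by apply: nwg; rewrite eq_sym.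
have residue h : h %% 5 \in [:: 0; a x %% 5; a y %% 5; a z %% 5; w %% 5].
  set rs := [:: _; _; _; _; _].
  have rs_uniq : uniq rs.
    rewrite /= !inE !negb_or !(eq_sym 0) nx ny nz nw nxy nxz nyz.
    by rewrite ![a _ %% 5 == w %% 5]eq_sym nwx nwy nwz.
  have rs_sub : {subset rs <= iota 0 5}.
    by move=> r; rewrite mem_iota !inE => /or4P[| | |/orP[]] /eqP ->; rewrite ?ltn_mod.
  have [|_ ->] := uniq_min_size rs_uniq rs_sub; first by [].
  by rewrite mem_iota ltn_mod.
have key i : i != t -> w = (a i + a x)%N \/ w = (a i + a y)%N \/ w = (a i + a z)%N.
  move=> it; have [h Hh hE] := wP _ (Ag i it); have Ah : apery H a t h.
    by apply: (apery_divisor minG Hh (sg_gen minG i)); rewrite addnC hE.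
  have hw : h <> w by move=> e; apply: (g0 i); move: hE; rewrite e -[RHS]add0n => /addIn.
  have h0 : h <> 0%N by move=> h0; apply: (wgen i) => //; rewrite -hE h0 addn0.
  have : [\/ h = a x, h = a y | h = a z]; last by rewrite -hE => -[] ->; [left|right; left|right; right].
  move: (residue h); rewrite !inE => /or4P[/eqP e|/eqP e|/eqP e|/orP[]/eqP e].
  - by case: h0; apply: mod5.
  - by constructor 1; apply: mod5.
  - by constructor 2; apply: mod5.
  - by constructor 3; apply: mod5.
  by case: hw; apply: mod5.
by split=> //; exists w; split=> //; split=> //; apply: key; rewrite eq_sym.
Qed.

Hypothesis t_min : [/\ a t < a x, a x < a y & a y < a z].

Let gen_rel i j h : i != j -> H h -> a j + h <> a i := @gen_subD H 4 a minG i j h.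

(* With every square reducible the Apery set lies in the subset sums of the
   three larger generators; symmetry then leaves either all eight of them or
   {0, a x, a y, a z, a x + a z}. *)
Lemma apery_of_squares :
  (forall h, apery H a t h -> exists i j k,
     [/\ i <= 1, j <= 1, k <= 1 & h = i * a x + j * a y + k * a z]) ->
  a t = 5 \/ apery H a t (a x + a y + a z).
Proof.
move=> sums; have [xy_lt yz_lt] : a x < a y /\ a y < a z by case: t_min.
have [tx ty tz [xy xz yz]] := idx_neq idx.
have [w Aw wP] := symmetric_apery minG t symH.
have [w0 wgen] := max_apery_not_gen wP.
have Ag i : i != t -> apery H a t (a i) := @apery_gen _ _ _ minG t i.
have Ax : apery H a t (a x) by apply: Ag; rewrite eq_sym.
have Ay : apery H a t (a y) by apply: Ag; rewrite eq_sym.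
have Az : apery H a t (a z) by apply: Ag; rewrite eq_sym.
have px := gen_gt0 minG x.
have Hg := sg_gen minG.
have r1 : a x + a y <> a z by apply: gen_rel; rewrite // eq_sym.
have r2 : a x + a x <> a z by apply: gen_rel; rewrite // eq_sym.
have r3 : a x + a x <> a y by apply: gen_rel; rewrite // eq_sym.
have r5 : a y + a y <> a z by apply: gen_rel; rewrite // eq_sym.
have compl h : apery H a t h -> exists i j k,
    [/\ i <= 1, j <= 1, k <= 1 & h + (i * a x + j * a y + k * a z) = w].
  move=> Ah; have [h' Hh' hE] := wP _ Ah.
  have /sums[i [j [k [? ? ? e]]]] : apery H a t h'.
    by apply: (apery_divisor minG Hh' (proj1 Ah)); rewrite addnC hE.
  by exists i, j, k; rewrite -e.
have nx := wgen x ltac:(by rewrite eq_sym).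
have ny := wgen y ltac:(by rewrite eq_sym).
have nz := wgen z ltac:(by rewrite eq_sym).
have [|wn] := eqVneq w (a x + a y + a z); first by move=> <-; right.
left.
(* Among the sums of two generators, [a y + a z] fails at the complement of [a x] and [a x + a y] at
   that of [a z]; for [a x + a z] the complement of [a y] can only be [a y]. *)
have [w1 w2] : w = a x + a z /\ w = a y + a y.
  have [i [j [k [i1 j1 k1 wE]]]] := sums w Aw.
  have [ix [jx [kx [ix1 jx1 kx1 xE]]]] := compl _ Ax.
  have [iy [jy [ky [iy1 jy1 ky1 yE]]]] := compl _ Ay.
  have [iz [jz [kz [iz1 jz1 kz1 zE]]]] := compl _ Az.
  clear -xy_lt yz_lt px r1 r2 r3 r5 nx ny nz w0 wn i1 j1 k1 wE ix1 jx1 kx1 xE iy1 jy1 ky1 yE iz1 jz1 kz1 zE.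
  move: (a x) (a y) (a z) xy_lt yz_lt px r1 r2 r3 r5 nx ny nz w0 wn wE xE yE zE => p q r.
  move=> xy_lt yz_lt px r1 r2 r3 r5 nx ny nz w0 wn wE xE yE zE.
  case: i j k i1 j1 k1 wE => [|[|//]] [|[|//]] [|[|//]] _ _ _; rewrite ?mul0n ?mul1n => wE; try (exfalso; lia).
  - exfalso; clear yE zE; move: ix jx kx ix1 jx1 kx1 xE => [|[|//]] [|[|//]] [|[|//]] _ _ _; lia.
  - clear xE zE; move: iy jy ky iy1 jy1 ky1 yE => [|[|//]] [|[|//]] [|[|//]] _ _ _; lia.
  exfalso; clear xE yE; move: iz jz kz iz1 jz1 kz1 zE => [|[|//]] [|[|//]] [|[|//]] _ _ _; lia.
have five h : apery H a t h -> h \in [:: 0; a x; a y; a z; w].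
  move=> Ah; have [i [j [k [i1 j1 k1 hE]]]] := sums h Ah.
  have [h' Hh' hw] := wP _ Ah; rewrite !inE.
  have r4 : a y + h' <> a z by apply: gen_rel; rewrite // eq_sym.
  move: i j k i1 j1 k1 hE => [|[|//]] [|[|//]] [|[|//]] _ _ _; rewrite ?mul0n ?mul1n => hE;
    clear -hE hw r4 w1 w2 xy_lt yz_lt px; lia.
have apery5 : forall h, h \in [:: 0; a x; a y; a z; w] -> apery H a t h.
  by move=> h; rewrite !inE => /or4P[| | |/orP[]] /eqP -> //; apply: apery0.
have t0 := gen_gt0 minG t.
(* Each residue modulo [a t] has exactly one Apery element, so counting residues gives [a t = 5]. *)
pose rs := [seq h %% a t | h <- [:: 0; a x; a y; a z; w]].
have urs : uniq rs.
  rewrite map_inj_in_uniq; last by move=> h h' /apery5 Ah /apery5 Ah'; apply: (apery_mod minG).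
  rewrite /= !inE !negb_or; clear -w1 w2 xy_lt yz_lt px; lia.
have sub1 : {subset rs <= iota 0 (a t)}.
  by move=> r /mapP[h _ ->]; rewrite mem_iota ltn_mod.
have sub2 : {subset iota 0 (a t) <= rs}.
  move=> r; rewrite mem_iota => /andP[_ rt]; have [h Ah hr] := apery_residue minG t numH r.
  by apply/mapP; exists h; rewrite ?five // hr modn_small.
have := uniq_leq_size urs sub1; have := uniq_leq_size (iota_uniq 0 _) sub2.
by rewrite size_map size_iota /= => ? ?; apply/eqP; rewrite eqn_leq; apply/andP.
Qed.
End Labelled.
End FourGeneratedSymmetric.

(** * From quadratic cones to multiplicity five, and the generators there *)

Section SymmetricFourGenerated.
Variables (H : nat -> Prop) (a : 'I_4 -> nat).
Hypothesis minG : min_gen_set H a.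
Hypothesis numH : numerical_semigroup H.
Hypothesis symH : symmetric_sg H.

Let inj : injective a. Proof. by case: minG. Qed.
Let agt0 := gen_gt0 minG.

(** If i occurred in the second factorization, cancelling it would leave a factorization of [a i],
    which is unique. *)
Lemma second_square (K : fieldType) i j : quadratic K a -> a j < a i ->
  exists2 m, wt a m = a i * 2 & m i = 0.
Proof.
move=> qa lt_ji; have [m mE mn] := quadratic_second_factorization qa lt_ji.
exists m; first by rewrite mE muln2.
apply/eqP; apply: contraNT mn => mi.
have le_im : (U_(i) <= m)%MM by rewrite lep1mP.
have mE' := submK le_im.
have w1 : wt a (m - U_(i))%MM = a i.
  by move: mE; rewrite -{1}mE' wtD wtU -addnn => /addIn.
by rewrite -mE' (gen_lone minG w1) mulmS mulm1n eqxx.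
Qed.

Section Labelled.
Variables t x y z : 'I_4.
Hypothesis idx : uniq [:: t; x; y; z].
Hypothesis t_min : [/\ a t < a x, a x < a y & a y < a z].

(** By size and minimality, 2 a_x cannot be written with y and z alone. A factorization of 2 a_y in
    x and z is xz, or contains x^2, which is exchanged for [mx]. For 2 a_z an x^2 or y^2 is
    exchanged likewise; there [my] = xz is excluded, since it would leave [a z] equal to [a x] plus
    an element of H. *)
Lemma quadratic_squares (K : fieldType) : quadratic K a -> exists mx my mz,
  [/\ wt a mx = a x * 2, wt a my = a y * 2 & wt a mz = a z * 2] /\
  [/\ 0 < mx t, 0 < mz t & 0 < my t \/ my = (U_(x) + U_(z))%MM].
Proof.
move=> qa; have [tx_lt xy_lt yz_lt] := t_min.
have [tx ty tz [xy xz yz]] := idx_neq idx.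
have px := agt0 x.
have r2 : a x + a x <> a z by apply: (gen_subD minG); [rewrite eq_sym|apply: (sg_gen minG)].
have r3 : a x + a x <> a y by apply: (gen_subD minG); [rewrite eq_sym|apply: (sg_gen minG)].
have r5 : a y + a y <> a z by apply: (gen_subD minG); [rewrite eq_sym|apply: (sg_gen minG)].
have swap i (m m' : 'X_{1..4}) : wt a m' = a i * 2 -> 2 <= m i ->
    wt a (m' + (m - U_(i) *+ 2))%MM = wt a m.
  move=> wm' mi; have le_im : (U_(i) *+ 2 <= m)%MM.
    apply/mnm_lepP => j; rewrite mulmnE mnm1E.
    by case: eqP => [<-|]; rewrite ?mul1n ?mul0n.
  by rewrite -[in RHS](submK le_im) wtD [RHS]wtD wtMn wtU wm' addnC.
have [mx mxE mxx] := second_square qa tx_lt.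
have mxt : 0 < mx t.
  rewrite lt0n; apply/eqP => mxt; move: mxE; rewrite (wt4 idx) mxt mxx.
  clear -xy_lt yz_lt px r2 r3.
  case: (mx y) => [|[|k]]; case: (mx z) => [|[|l]]; rewrite ?mulSn; lia.
have [my0 my0E my0y] := second_square qa (ltn_trans tx_lt xy_lt).
have [my myE myP] : exists2 my, wt a my = a y * 2 & 0 < my t \/ my = (U_(x) + U_(z))%MM.
  case: (posnP (my0 t)) => [my0t|]; last by exists my0 => //; left.
  case: (ltnP 1 (my0 x)) => my0x.
    exists (mx + (my0 - U_(x) *+ 2))%MM; first by rewrite swap.
    by left; rewrite mnmDE addn_gt0 mxt.
  exists my0 => //; right; apply: (mnm4P idx); rewrite !mnmDE !mnm1E;
    have [/negbTE tx' /negbTE ty' /negbTE tz' [/negbTE xy' /negbTE xz' /negbTE yz']] := idx_neq idx;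
    rewrite ?(eq_sym x t) ?(eq_sym z t) ?(eq_sym z x) ?(eq_sym z y) ?tx' ?tz' ?xy' ?xz' ?yz' ?eqxx //;
    move: my0E; rewrite (wt4 idx) my0t my0y; clear -xy_lt yz_lt px r3 r5 my0x;
    case: (my0 x) my0x => [|[|//]] _; case: (my0 z) => [|[|k]]; rewrite ?mulSn; lia.
have [mz0 mz0E mz0z] := second_square qa (ltn_trans tx_lt (ltn_trans xy_lt yz_lt)).
have [mz mzE mzt] : exists2 mz, wt a mz = a z * 2 & 0 < mz t.
  case: (posnP (mz0 t)) => [mz0t|]; last by exists mz0.
  case: (ltnP 1 (mz0 x)) => mz0x.
    exists (mx + (mz0 - U_(x) *+ 2))%MM; first by rewrite swap.
    by rewrite mnmDE addn_gt0 mxt.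
  case: (ltnP 1 (mz0 y)) => mz0y; last first.
    move: mz0E; rewrite (wt4 idx) mz0t mz0z; clear -xy_lt yz_lt px mz0x mz0y.
    by case: (mz0 x) mz0x => [|[|//]] _; case: (mz0 y) mz0y => [|[|//]] _; rewrite ?mulSn; lia.
  case: myP => [myt|myE'].
    exists (my + (mz0 - U_(y) *+ 2))%MM; first by rewrite swap.
    by rewrite mnmDE addn_gt0 myt.
  have := swap y mz0 my myE mz0y; rewrite myE' mz0E !wtD !wtU => e.
  case: (gen_subD minG _ (sgW minG (mz0 - U_(y) *+ 2)) (i := z) (j := x)); first by rewrite eq_sym.
  by clear -e; lia.
by exists mx, my, mz.
Qed.

Lemma quadratic_mult5_sorted (K : fieldType) :
  quadratic K a -> ~ complete_intersection K a -> a t = 5.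
Proof.
move=> qa nCI; have [tx_lt xy_lt yz_lt] := t_min.
have [mx [my [mz [[mxE myE mzE] [mxt mzt myP]]]]] := quadratic_squares qa.
have [|//|Axyz] := @apery_of_squares H a minG numH symH t x y z idx t_min.
  move=> h [/(sg_wt minG)[m mh] ap].
  have [v [cv wv _]] := square_canonical idx K agt0 mxE myE mzE mxt mzt myP m.
  have vt : v t = 0.
    apply/eqP/negPn/negP => vt; have le_tv : (U_(t) <= v)%MM by rewrite lep1mP.
    apply: (ap (wt a (v - U_(t))%MM)); first exact: sgW.
    by rewrite -mh -wv -[in RHS](submK le_tv) wtD wtU.
  exists (v x), (v y), (v z); case/and3P: cv => vx vy vz; split=> //.
  by rewrite -mh -wv (wt4 idx) vt.
case: nCI; apply: (complete_intersection_of_squares idx K agt0 (gen_lone minG) mxE myE mzE) => //.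
(* For [a x < a y < a z] this is the only possible coincidence among the eight subset sums. *)
have r1 : a x + a y <> a z.
  have [_ _ _ [_ xz _]] := idx_neq idx.
  by apply: (gen_subD minG); [rewrite eq_sym|apply: (sg_gen minG)].
have Hsum i j k : H (i * a x + j * a y + k * a z).
  by rewrite -!(wtU a) -!(mulnC (wt _ _)) -!wtMn -!wtD; apply: (sgW minG).
have sub_apery (m : 'X_{1..4}) : canonical x y z m -> apery H a t (m x * a x + m y * a y + m z * a z).
  case/and3P=> mx1 my1 mz1.
  apply: (@apery_divisor _ _ _ minG t _ ((1 - m x) * a x + (1 - m y) * a y + (1 - m z) * a z)).
  - exact: Hsum.
  - exact: Hsum.
  congr apery: Axyz; move: mx1 my1 mz1.
  by case: (m x) => [|[|//]]; case: (m y) => [|[|//]]; case: (m z) => [|[|//]] _ _ _; lia.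
(* A larger exponent of t on one side would allow [a t] to be subtracted from a subset sum, which is
   in the Apery set as a summand of [a x + a y + a z]. *)
have le_t (m m' : 'X_{1..4}) : canonical x y z m -> canonical x y z m' -> wt a m = wt a m' -> m' t <= m t.
  move=> cm cm' e; rewrite leqNgt; apply/negP => lt_t.
  have [_ ap] := sub_apery m cm.
  apply: (ap ((m' t - (m t).+1) * a t + (m' x * a x + m' y * a y + m' z * a z))).
    by apply: (sgD minG); [apply/(sgM minG)/(sg_gen minG)|case: (sub_apery m' cm')].
  move: e; rewrite !(wt4 idx) -(subnK lt_t) mulnDl mulSn; lia.
move=> m m' cm cm' e; have et : m t = m' t by apply/eqP; rewrite eqn_leq !le_t.
case/and3P: cm => mx1 my1 mz1; case/and3P: cm' => mx1' my1' mz1'.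
have px := agt0 x; move: e; rewrite !(wt4 idx) et -!addnA => /addnI.
move: (mnm4P idx et); move: mx1 my1 mz1 mx1' my1' mz1'.
clear -xy_lt yz_lt px r1.
case: (m x) => [|[|//]]; case: (m y) => [|[|//]]; case: (m z) => [|[|//]];
case: (m' x) => [|[|//]]; case: (m' y) => [|[|//]]; case: (m' z) => [|[|//]] _ _ _ _ _ _ + e;
  rewrite ?mul0n ?mul1n in e; try (by apply); move=> _; exfalso; lia.
Qed.
End Labelled.

Lemma quadratic_mult5 (K : fieldType) :
  quadratic K a -> ~ complete_intersection K a -> multiplicity_is a 5.
Proof.
move=> qa nCI; have [t [x [y [z [idx tx xy yz]]]]] := idx_sorted inj.
have t5 : a t = 5 by apply: (quadratic_mult5_sorted idx _ qa nCI).
split; first by exists t.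
by move=> i; case: (idx_cover idx i) => ->; lia.
Qed.

(** Solving for X and Y gives 10 X = 3 a_x - a_z and 5 Y = 2 a_z - a_x. The congruence a_x = 3 a_y
    modulo 5 decides which outer generator is called x. *)
Lemma mult5_structure : multiplicity_is a 5 -> exists t x y z X Y,
  [/\ uniq [:: t; x; y; z], a t = 5,
      [/\ a x = 4 * X + Y, a y = 3 * X + 2 * Y & a z = 2 * X + 3 * Y],
      0 < X & 0 < Y] /\ X %% 5 != Y %% 5.
Proof.
move=> [[t t5] _].
suff [x [y [z [idx yE xy3]]]] : exists x y z,
    [/\ uniq [:: t; x; y; z], a y + a y = a x + a z & a x %% 5 = (3 * a y) %% 5].
  have [tx ty tz [xy xz yz]] := idx_neq idx.
  have zx : a z + a z <> a x by apply: (gen_subD minG) => //; apply: (sg_gen minG).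
  (* Positivity of X and Y: if [a i] were at least the multiple [k * a j] congruent to it, it would
     be that multiple plus a multiple of 5. *)
  have lift i j k n : a i %% 5 = (k * a j) %% 5 -> i != j -> 1 < k -> n = k * a j -> a i < n.
    move=> e ij k1 ->; rewrite ltnNge; apply/negP => le_ji.
    have /dvdnP[q qE] : 5 %| a i - k * a j by rewrite -eqn_mod_dvd // e.
    apply: (gen_subD minG ij (h := (k - 1) * a j + q * a t)).
      by apply: (sgD minG); apply: (sgM minG); apply: (sg_gen minG).
    by rewrite t5; case: k k1 qE le_ji {e} => [|k] //; rewrite subSS subn0 mulSn; lia.
  have xz2 : a x < 2 * a z by apply: (lift x z 2) => //; clear -yE xy3; lia.
  have zx3 : a z < 3 * a x by apply: (lift z x 3); rewrite // 1?eq_sym //; clear -yE xy3; lia.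
  have /dvdnP[X XE] : 10 %| 3 * a x - a z by clear -yE xy3 zx3; lia.
  have /dvdnP[Y YE] : 5 %| 2 * a z - a x by clear -yE xy3 xz2; lia.
  (* Modulo 5, [a x] = 4 X + Y is Y - X. *)
  have n5 : a x %% 5 != 0.
    by have [] := five_residues minG symH idx t5.
  exists t, x, y, z, X, Y; split; first split=> //.
  - by split; clear -XE YE zx3 xz2 yE; lia.
  - by clear -XE zx3; lia.
  - by clear -YE xz2; lia.
  by clear -XE YE zx3 xz2 yE n5; lia.
have [x [y [z idx]]] := idx_complete t.
have [nx ny nz [nxy nxz nyz] [w [_ [[nw nwx nwy nwz] wx wy wz]]]] := five_residues minG symH idx t5.
(* Taking the complement in w is an involution of three generators: it fixes exactly one and
   exchanges the others. *)
have middle : [\/ a x + a x = a y + a z, a y + a y = a x + a z | a z + a z = a x + a y].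
  clear -wx wy wz nxy nxz nyz.
  have h b c : b %% 5 != c %% 5 -> b <> c by move=> + e; rewrite e eqxx.
  move/h: nxy; move/h: nxz; move/h: nyz; clear h; move: (a x) (a y) (a z) wx wy wz => p q r.
  by move=> [|[]] ? [|[]] ? [|[]] ? *; (exfalso; lia) || (constructor 1; lia) ||
    (constructor 2; lia) || (constructor 3; lia).
have perm (x' y' z' : 'I_4) : perm_eq [:: t; x'; y'; z'] [:: t; x; y; z] -> uniq [:: t; x'; y'; z'].
  by move=> /perm_uniq ->.
have [x' [y' [z' [idx' yE']]]] : exists x' y' z',
    uniq [:: t; x'; y'; z'] /\ a y' + a y' = a x' + a z'.
  case: middle => e.
  - by exists y, x, z; split=> //; apply: perm; apply/permP => P /=; clear; lia.
  - by exists x, y, z.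
  by exists x, z, y; split=> //; apply: perm; apply/permP => P /=; clear; lia.
have [nx' ny' nz' [nxy' nxz' nyz'] [w' [_ [[nw' nwx' nwy' nwz'] _ _ _]]]] :=
  five_residues minG symH idx' t5.
have [e|e] : a x' %% 5 = (3 * a y') %% 5 \/ a z' %% 5 = (3 * a y') %% 5.
- clear -nx' ny' nz' nxy' nxz' nyz' yE'; lia.
- by exists x', y', z'.
exists z', y', x'; split=> //; last by rewrite addnC.
by rewrite (perm_uniq (s2 := [:: t; x'; y'; z'])) //; apply/permP => P /=; clear; lia.
Qed.
End SymmetricFourGenerated.

(** * Generators and parameters in form (d) *)

Section FormD.
Variables (H : nat -> Prop) (a : 'I_4 -> nat).
Hypothesis minG : min_gen_set H a.
Implicit Types X Y : nat.

(** A minimal generator belongs to every generating set, and four distinct ones fill a list of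
    four. *)
Lemma form_d_gens X Y : form_d H X Y ->
  perm_eq [seq a i | i <- enum 'I_4] [:: 5; 4 * X + Y; 2 * X + 3 * Y; 3 * X + 2 * Y].
Proof.
set s := [:: _; _; _; _] => -[X0 Y0 _ HE].
have [inj _ _] := minG.
have ua : uniq [seq a i | i <- enum 'I_4] by rewrite map_inj_uniq // enum_uniq.
have sub : {subset [seq a i | i <- enum 'I_4] <= s}.
  move=> _ /mapP[i _ ->].
  have sP u : [\/ u = 5, u = 4 * X + Y, u = 2 * X + 3 * Y | u = 3 * X + 2 * Y] -> H u /\ u \in s.
    move=> Su; split; first by apply/HE/in_genW.
    by rewrite !inE; case: Su => ->; rewrite eqxx ?orbT.
  have := sg_gen minG i; rewrite HE; move ai: (a i) => h Hh.
  case: Hh ai => [ai|u v /sP[Hu us] /HE Hv ai].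
    by have := gen_gt0 minG i; rewrite ai.
  have [u0|->] := gen_split minG Hu Hv (esym ai); last by rewrite addn0.
  by move: us; rewrite u0 !inE; clear -X0 Y0; lia.
have szE : size s <= size [seq a i | i <- enum 'I_4] by rewrite size_map size_enum_ord.
have [_ e] := uniq_min_size ua sub szE.
by apply: uniq_perm => //; apply: leq_size_uniq ua sub szE.
Qed.

Lemma form_d_mult5 X Y : form_d H X Y -> multiplicity_is a 5.
Proof.
move=> fd; have := form_d_gens fd => /perm_mem e; have [X0 Y0 _ _] := fd; split.
  have : 5 \in [seq a i | i <- enum 'I_4] by rewrite e inE eqxx.
  by move=> /mapP[i _ ->]; exists i.
move=> i; have : a i \in [seq a i | i <- enum 'I_4] by apply/map_f/mem_enum.
by rewrite e !inE => /or4P[] /eqP ->; lia.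
Qed.

(** The sum of the generators determines 3 X + 2 Y. Matching 4 X + Y with anything but 4 X' + Y'
    would make X and Y congruent modulo 5. *)
Lemma form_d_unique X Y X' Y' : form_d H X Y -> form_d H X' Y' -> X = X' /\ Y = Y'.
Proof.
move=> fd fd'; have := perm_trans (etrans (perm_sym _ _) (form_d_gens fd)) (form_d_gens fd').
move: fd fd' => [X0 Y0 d _] [X0' Y0' d' _] p.
have := perm_sumn p; have := perm_mem p (4 * X + Y); rewrite /= !inE eqxx orbT.
clear p; case: eqP => [|_]; first by lia.
case: eqP => [|_]; first by lia.
case: eqP => [|_]; first by lia.
by case: eqP => // ; lia.
Qed.

Lemma mult5_form_d : symmetric_sg H -> multiplicity_is a 5 -> exists X Y, form_d H X Y.
Proof.
move=> symH /(mult5_structure minG symH)[t [x [y [z [X [Y [[idx t5 [xE yE zE] X0 Y0] d]]]]]]].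
have [_ HE _] := minG.
exists X, Y; split=> // h; rewrite HE; split; apply: in_gen_sub => u.
  by move=> [i <-]; apply: in_genW; case: (idx_cover idx i) => ->; rewrite ?t5 ?xE ?yE ?zE;
    [constructor 1|constructor 2|constructor 4|constructor 3].
by move=> [] ->; apply: in_genW; [exists t|exists x|exists z|exists y].
Qed.
End FormD.

(** * Multiplicity five *)

Local Open Scope ring_scope.

Section FlagTheory.
Variables (K : fieldType) (n : nat) (J : {mpoly K[n]} -> Prop).
Hypothesis idJ : is_ideal J.
Variables (r : nat) (l : 'I_r -> {mpoly K[n]}).

Lemma flag_is_ideal k : is_ideal (flag J l k).
Proof.
split.
- by exists (fun _ => 0); rewrite big1 ?subr0 => [|i _]; [apply: (ideal0 idJ)|rewrite mul0r].
- move=> p q [c Jc] [d Jd]; exists (fun i => c i + d i).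
  under eq_bigr do rewrite mulrDl.
  by rewrite big_split opprD addrACA; apply: (idealD idJ).
move=> u p [c Jc]; exists (fun i => u * c i).
under eq_bigr do rewrite -mulrA.
by rewrite -mulr_sumr -mulrBr; apply: (idealM idJ).
Qed.

Lemma flagJ k p : J p -> flag J l k p.
Proof. by exists (fun _ => 0); rewrite big1 ?subr0 // => i _; rewrite mul0r. Qed.

Lemma flag_gen k (i : 'I_r) : (i < k)%N -> flag J l k (l i).
Proof.
move=> ik; exists (fun j => (j == i)%:R); rewrite (bigD1 i) //= eqxx mul1r big1.
  by rewrite addr0 subrr; apply: (ideal0 idJ).
by move=> j /andP[_ /negbTE ->]; rewrite mul0r.
Qed.

Lemma flag_ind (P : {mpoly K[n]} -> Prop) k :
  (forall p, J p -> P p) -> (forall p q, P p -> P q -> P (p + q)) ->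
  (forall c (i : 'I_r), (i < k)%N -> P (c * l i)) -> forall p, flag J l k p -> P p.
Proof.
move=> PJ PD Pl p [c Jc]; rewrite -(subrK (\sum_(i < r | (i < k)%N) c i * l i) p).
apply: (PD); first exact: (PJ).
by elim/big_ind: _ => [|u v|i ik]; [apply: PJ; apply: (ideal0 idJ)|apply: PD|apply: Pl].
Qed.
End FlagTheory.

Section MultiplicityFive.
Variables (K : fieldType) (H : nat -> Prop) (a : 'I_4 -> nat).
Hypothesis minG : min_gen_set H a.
Hypothesis symH : symmetric_sg H.
Variables (t x y z : 'I_4) (X Y : nat).
Hypothesis idx : uniq [:: t; x; y; z].
Hypothesis t5 : a t = 5.
Hypothesis xE : a x = (4 * X + Y)%N.
Hypothesis yE : a y = (3 * X + 2 * Y)%N.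
Hypothesis zE : a z = (2 * X + 3 * Y)%N.
Hypothesis X0 : (0 < X)%N.
Hypothesis Y0 : (0 < Y)%N.
Hypothesis XY : (X %% 5 != Y %% 5)%N.

Local Notation J := (@IHstar K 4 a).
Let agt0 := gen_gt0 minG.
Let idJ : is_ideal J := @IHstar_is_ideal K 4 a.

(** Complements in w fix one generator and exchange the other two; fixing x or z would give X =
    Y. *)
Lemma apery_2y : apery H a t (a y + a y).
Proof.
have [_ _ _ _ [w [Aw [_ wx wy wz]]]] := five_residues minG symH idx t5.
suff -> : (a y + a y)%N = w by [].
have nXY : X <> Y by move=> e; move: XY; rewrite e eqxx.
clear -xE yE zE nXY wx wy wz; lia.
Qed.

Lemma wt_xx : wt a (U_(x) + U_(x))%MM = wt a (U_(t) *+ X + U_(y))%MM.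
Proof. by rewrite !wtD !wtMn !wtU t5 xE yE; lia. Qed.
Lemma wt_xy : wt a (U_(x) + U_(y))%MM = wt a (U_(t) *+ X + U_(z))%MM.
Proof. by rewrite !wtD !wtMn !wtU t5 xE yE zE; lia. Qed.
Lemma wt_zz : wt a (U_(z) + U_(z))%MM = wt a (U_(t) *+ Y + U_(x))%MM.
Proof. by rewrite !wtD !wtMn !wtU t5 xE zE; lia. Qed.
Lemma wt_yz : wt a (U_(y) + U_(z))%MM = wt a (U_(t) *+ (X + Y))%MM.
Proof. by rewrite !wtD !wtMn !wtU t5 yE zE; lia. Qed.
Lemma wt_xz : wt a (U_(x) + U_(z))%MM = wt a (U_(y) + U_(y))%MM.
Proof. by rewrite !wtD !wtU xE yE zE; lia. Qed.

Definition lifts (m : 'X_{1..4}) :=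
  exists u, [/\ wt a u = wt a m, (mdeg m <= mdeg u)%N & (0 < u t)%N].

(** A monomial off the list is divisible by t, by one of x^2, xy, yz, z^2, whose other
    factorizations contain t and have length at least 2, or by y^3. *)
Lemma lifts_or_standard m : lifts m \/
  m \in [:: 0%MM; U_(x)%MM; U_(y)%MM; U_(z)%MM; (U_(x) + U_(z))%MM; (U_(y) + U_(y))%MM].
Proof.
have [/negbTE tx /negbTE ty /negbTE tz [/negbTE xy /negbTE xz /negbTE yz]] := idx_neq idx.
have neqE := (tx, ty, tz, xy, xz, yz).
have red (b b' s u : 'X_{1..4}) : wt a b = wt a b' -> mdeg b = 2 -> (1 < mdeg b')%N ->
    (0 < b' t)%N -> (b + s)%MM = u -> lifts u.
  move=> wb db db' bt <-; exists (b' + s)%MM; split.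
  - by rewrite !wtD wb.
  - by rewrite !mdegD db leq_add2r.
  by rewrite mnmDE addn_gt0 bt.
have redE (i j : 'I_4) (b' u : 'X_{1..4}) : wt a (U_(i) + U_(j))%MM = wt a b' ->
    (1 < mdeg b')%N -> (0 < b' t)%N -> (U_(i) + U_(j) <= u)%MM -> lifts u.
  move=> wb db' bt le_u; apply: (red _ b' (u - (U_(i) + U_(j)))%MM _ wb) => //.
    by rewrite mdegD !mdeg1.
  by rewrite addmC submK.
have lex i j (u : 'X_{1..4}) : ((i == j) < u i)%N -> (0 < u j)%N -> (U_(i) + U_(j) <= u)%MM.
  move=> ui uj; apply/mnm_lepP => k; rewrite mnmDE !mnm1E.
  case: (eqVneq i k) => [<-|ik]; first by rewrite (eq_sym j) add1n.
  by case: (eqVneq j k) => [<-|].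
have mdX b i : (0 < b)%N -> (1 < mdeg (U_(t) *+ b + U_(i))%MM)%N.
  by move=> b0; rewrite mdegD mdegMn !mdeg1 mul1n addn1 ltnS.
have mt b (c : 'X_{1..4}) : (0 < b)%N -> (0 < (U_(t) *+ b + c)%MM t)%N.
  by move=> b0; rewrite mnmDE mulmnE mnm1E eqxx mul1n addn_gt0 b0.
have lxx (u : 'X_{1..4}) : (1 < u x)%N -> lifts u.
  move=> ux; apply: (redE x x _ u wt_xx); rewrite ?mdX ?mt //.
  by apply: lex; rewrite ?eqxx // ltnW.
have lzz (u : 'X_{1..4}) : (1 < u z)%N -> lifts u.
  move=> ux; apply: (redE z z _ u wt_zz); rewrite ?mdX ?mt //.
  by apply: lex; rewrite ?eqxx // ltnW.
have lxy (u : 'X_{1..4}) : (0 < u x)%N -> (0 < u y)%N -> lifts u.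
  move=> ux uy; apply: (redE x y _ u wt_xy); rewrite ?mdX ?mt //.
  by apply: lex; rewrite ?xy.
have lyz (u : 'X_{1..4}) : (0 < u y)%N -> (0 < u z)%N -> lifts u.
  move=> uy uz; apply: (redE y z _ u wt_yz).
  - by rewrite mdegMn mdeg1 mul1n -addn1 leq_add.
  - by rewrite mulmnE mnm1E eqxx mul1n addn_gt0 X0.
  by apply: lex; rewrite ?yz.
case: (posnP (m t)) => mt0; last by left; exists m.
case: (ltnP 1 (m x)) => mx; first by left; apply: lxx.
case: (ltnP 1 (m z)) => mz; first by left; apply: lzz.
case: (posnP (m y)) => my.
  right; rewrite !inE; move: mx mz.
  case mxE: (m x) => [|[|//]]; case mzE: (m z) => [|[|//]] _ _.
  - suff -> : m = 0%MM by rewrite eqxx.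
    by apply: (mnm4P idx); rewrite ?mt0 ?mxE ?my ?mzE mnm0E.
  - suff -> : m = U_(z)%MM by rewrite eqxx !orbT.
    by apply: (mnm4P idx); rewrite ?mt0 ?mxE ?my ?mzE mnm1E ?(eq_sym z) ?neqE ?eqxx.
  - suff -> : m = U_(x)%MM by rewrite eqxx !orbT.
    by apply: (mnm4P idx); rewrite ?mt0 ?mxE ?my ?mzE mnm1E ?(eq_sym x t) ?neqE ?eqxx.
  suff -> : m = (U_(x) + U_(z))%MM by rewrite eqxx !orbT.
  by apply: (mnm4P idx); rewrite ?mt0 ?mxE ?my ?mzE mnmDE !mnm1E ?(eq_sym z) ?(eq_sym x t) ?neqE ?eqxx.
case: (posnP (m x)) => [mx0|]; last by left; apply: lxy.
case: (posnP (m z)) => [mz0|]; last by left; apply: lyz.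
case: (ltnP 2 (m y)) => my3.
  left; have le_u : (U_(y) + U_(y) <= m)%MM by apply: lex; rewrite ?eqxx // ltnW.
  (* For y^3 the exchange of y^2 for xz keeps the length and makes the monomial divisible by xy. *)
  pose u := (U_(x) + U_(z) + (m - (U_(y) + U_(y))))%MM.
  have [v [wv dv vt]] : lifts u.
    by apply: lxy; rewrite /u !mnmDE !mnmBE ?mnmDE !mnm1E ?eqxx // ?addn_gt0 ?subn_gt0 my3 orbT.
  exists v; split=> //.
    by rewrite wv /u wtD wt_xz -wtD addmC submK.
  apply: leq_trans dv; rewrite /u -[X in (mdeg X <= _)%N](submK le_u) !mdegD !mdeg1.
  by rewrite addnC leqnn.
right; rewrite !inE; case myE: (m y) my my3 => [|[|[|//]]] // _ _.
  suff -> : m = U_(y)%MM by rewrite eqxx !orbT.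
  by apply: (mnm4P idx); rewrite ?mt0 ?mx0 ?myE ?mz0 mnm1E ?(eq_sym y t) ?(eq_sym y x) ?neqE ?eqxx.
suff -> : m = (U_(y) + U_(y))%MM by rewrite eqxx !orbT.
by apply: (mnm4P idx); rewrite ?mt0 ?mx0 ?myE ?mz0 mnmDE !mnm1E ?(eq_sym y t) ?(eq_sym y x) ?neqE ?eqxx.
Qed.

Lemma apery_not_lift (m u : 'X_{1..4}) : wt a u = wt a m -> (0 < u t)%N -> ~ apery H a t (wt a m).
Proof.
move=> e ut [_ ap]; have le_tu : (U_(t) <= u)%MM by rewrite lep1mP -lt0n.
by apply: (ap (wt a (u - U_(t))%MM)); [apply: (sgW minG)|rewrite -e -[in RHS](submK le_tu) wtD wtU].
Qed.

Lemma apery_gens : [/\ apery H a t (a x), apery H a t (a y) & apery H a t (a z)].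
Proof.
have [tx ty tz _] := idx_neq idx.
by split; apply: (apery_gen minG); rewrite eq_sym.
Qed.

(** The monomials on the standard list have weights in the Apery set, hence never in H + a t. This
    is the criterion for x_t to be a nonzerodivisor. *)
Lemma lifts_of_wt m m' : wt a m = wt a (m' + U_(t))%MM -> lifts m.
Proof.
move=> e; have [//|std] := lifts_or_standard m; exfalso.
have nap : ~ apery H a t (wt a m).
  by apply: (@apery_not_lift m (m' + U_(t))%MM); rewrite // mnmDE mnm1E eqxx addn1.
have [Ax Ay Az] := apery_gens; apply: nap; move: std; rewrite !inE.
case/or4P=> [| | |/or3P[]] /eqP ->; rewrite ?wt0 ?wtU //; first exact: (apery0 minG).
  by rewrite wt_xz wtD wtU; apply: apery_2y.
by rewrite wtD wtU; apply: apery_2y.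
Qed.

Lemma wt_2y (m : 'X_{1..4}) : wt a m = (a y + a y)%N ->
  (m == (U_(x) + U_(z))%MM) || (m == (U_(y) + U_(y))%MM).
Proof.
move=> e; have [[u [wu _ ut]]|] := lifts_or_standard m.
  by case: (apery_not_lift wu ut); rewrite e; apply: apery_2y.
have nXY : X <> Y by move=> e2; move: XY; rewrite e2 eqxx.
rewrite !inE => /or4P[| | |/or3P[]] /eqP mE; move: e; rewrite mE ?eqxx ?orbT // ?wt0 ?wtU;
  by have := agt0 y; clear -xE yE zE X0 Y0 nXY; try lia.
Qed.

(** The factorizations of 2 a_y are xz and y^2, both of length 2, so summing their coefficients
    annihilates I_H and also J. This functional bars a linear term in z in [colon_x]. *)
Lemma mcoeff_sum_2y (p : {mpoly K[4]}) : J p ->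
  p@_(U_(x) + U_(z))%MM + p@_(U_(y) + U_(y))%MM = 0.
Proof.
move: p; apply: IHstar_ind => [|p q p0 q0|c p p0|d f If _].
- by rewrite !mcoeff0 addr0.
- by rewrite !mcoeffD addrACA p0 q0 addr0.
- by rewrite !mcoeffZ -mulrDr p0 mulr0.
rewrite !hcompE !mdegD !mdeg1; case: eqP => // _; rewrite ?addr0 //.
have := IH_linext0 (fun h => (h == (a y + a y)%N)%:R : K^o) If.
rewrite /linext => <-; rewrite {1 2}(mpolyE f) !raddf_sum -big_split /=.
apply: eq_bigr => m _; rewrite !mcoeffZ !mcoeffX -mulrDr; congr (_ * _).
have [_ _ _ [/negbTE xy _ _]] := idx_neq idx.
have ne : ((U_(x) + U_(z))%MM == (U_(y) + U_(y))%MM :> 'X_{1..4}) = false.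
  apply/eqP => e; have := congr1 (fun m : 'X_{1..4} => m x) e.
  by rewrite !mnmDE !mnm1E eqxx (eq_sym y) xy.
case: (wt a m =P _) => [/wt_2y/orP[]/eqP ->|ne_w].
- by rewrite eqxx ne addr0.
- by rewrite eqxx eq_sym ne add0r.
have -> : (m == (U_(x) + U_(z))%MM) = false.
  by apply/eqP => e; apply: ne_w; rewrite e wt_xz wtD wtU.
have -> : (m == (U_(y) + U_(y))%MM) = false.
  by apply/eqP => e; apply: ne_w; rewrite e wtD wtU.
by rewrite addr0.
Qed.

Lemma IHstar_mcoeff0 (p : {mpoly K[4]}) : J p -> p@_0%MM = 0.
Proof.
apply: IHstar_lone_coef => m; rewrite wt0 => m0.
by apply/eqP; rewrite -mdeg_eq0 -leqn0; apply: leq_trans (mdeg_le_wt m agt0) _; rewrite m0.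
Qed.

Lemma IHstar_mcoeff1 (p : {mpoly K[4]}) i : J p -> p@_U_(i) = 0.
Proof. by apply: IHstar_lone_coef => m; rewrite wtU; apply: (gen_lone minG). Qed.

Definition lin_var (i : 'I_4) : {mpoly K[4]} := 'X_(nth t [:: t; x; y; z] i).

(* The number of variables, in the order t, x, y, z, that generate modulo J the
   ideal quotient of (J, the variables before the i-th) by the i-th. *)
Definition colon_idx (i : 'I_4) : nat := nth 0%N [:: 0; 3; 4; 4]%N i.

Local Notation F := (flag J lin_var).
Let idF k : is_ideal (F k) := flag_is_ideal idJ lin_var k.

Lemma flag_var k (i : 'I_4) p : (i < k)%N -> F k (p * lin_var i).
Proof. by move=> ik; apply: (idealM (idF k)); apply: flag_gen. Qed.

Lemma flag4P p : p@_0%MM = 0 <-> F 4 p.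
Proof.
split=> [p0|].
  apply: (ideal_generated_by_linear (idF 4)) p0 => i.
  have [k ->] : exists k : 'I_4, 'X_i = lin_var k.
    by case: (idx_cover idx i) => ->; [exists (@Ordinal 4 0 isT)|exists (@Ordinal 4 1 isT)
      |exists (@Ordinal 4 2 isT)|exists (@Ordinal 4 3 isT)].
  exact: flag_gen.
apply: (flag_ind idJ (P := fun q => q@_0%MM = 0)) => [q|q q' q0 q'0|c i _]; first exact: IHstar_mcoeff0.
  by rewrite mcoeffD q0 q'0 addr0.
rewrite mcoeffMXr; case: ifP => // /mnm_lepP/(_ (nth t [:: t; x; y; z] i)).
by rewrite mnm1E eqxx mnm0E.
Qed.

Lemma mcoeff_flag_lin (i : 'I_4) p : F i p -> p@_U_(nth t [:: t; x; y; z] i) = 0.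
Proof.
apply: (flag_ind idJ (P := fun q => q@_U_(_) = 0)) => [q|q q' q0 q'0|c j ji]; first exact: IHstar_mcoeff1.
  by rewrite mcoeffD q0 q'0 addr0.
rewrite mcoeffMXr; case: ifP => // /mnm_lepP/(_ (nth t [:: t; x; y; z] j)).
rewrite !mnm1E eqxx nth_uniq //; case: eqP => // e.
by rewrite e ltnn in ji.
Qed.

(** A constant term of p would give [p * lin_var i] a linear term in the i-th variable, but J has no
    linear terms and the i-th variable is not among the earlier ones. *)
Lemma mcoeff0_of_colon (i : 'I_4) p : F i (p * lin_var i) -> p@_0%MM = 0.
Proof. by move/mcoeff_flag_lin; rewrite -[X in _@_X]addm0 mcoeffMX. Qed.

Lemma flag_mon k (i : 'I_4) (m : 'X_{1..4}) :
  (i < k)%N -> (0 < m (nth t [:: t; x; y; z] i))%N -> F k 'X_[m].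
Proof.
rewrite lt0n => ik mi; set j := nth _ _ _ in mi; have le_jm : (U_(j) <= m)%MM by rewrite lep1mP.
by rewrite -(submK le_jm) mpolyXD; apply: (@flag_var k i).
Qed.

Lemma flag_lift k (i : 'I_4) (m m' : 'X_{1..4}) : (i < k)%N ->
  wt a m = wt a m' -> (mdeg m <= mdeg m')%N ->
  (0 < m' (nth t [:: t; x; y; z] i))%N -> F k 'X_[m].
Proof.
move=> ik e le m'i; have := IHstar_binomial K e le.
case: ifP => _ /(flagJ lin_var k); last by rewrite subr0.
by move/(idealD (idF k))/(_ (flag_mon ik m'i)); rewrite subrK.
Qed.

(** Beyond products with an earlier variable, x^2, xy, yz and z^2 lift into (t), and y^2 equals xz
    modulo J. *)
Lemma colon_ge (i i' : 'I_4) : (i' < colon_idx i)%N -> F i (lin_var i' * lin_var i).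
Proof.
have [ltii' _|] := ltnP i' i; first by rewrite mulrC; apply: flag_var.
have tX b (c : 'X_{1..4}) : (0 < b)%N -> (0 < (U_(t) *+ b + c)%MM t)%N.
  by move=> b0; rewrite mnmDE mulmnE mnm1E eqxx mul1n addn_gt0 b0.
have dX b j : (0 < b)%N -> (2 <= mdeg (U_(t) *+ b + U_(j))%MM)%N.
  by move=> b0; rewrite mdegD mdegMn !mdeg1 mul1n addn1 ltnS.
have d2 j k : mdeg (U_(j) + U_(k) : 'X_{1..4})%MM = 2 by rewrite mdegD !mdeg1.
rewrite /lin_var -mpolyXD.
case: i i' => -[|[|[|[|//]]]] ? [[|[|[|[|//]]]] ?] //= _ _.
- by apply: (@flag_lift _ ord0 _ _ _ wt_xx); rewrite ?d2 ?dX ?tX.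
- by rewrite addmC; apply: (@flag_lift _ ord0 _ _ _ wt_xy); rewrite ?d2 ?dX ?tX.
- apply: (@flag_lift _ (@Ordinal 4 1 isT) _ _ _ (esym wt_xz)); rewrite ?d2 //=.
  by rewrite mnmDE mnm1E eqxx.
- rewrite addmC; apply: (@flag_lift _ ord0 _ _ _ wt_yz); rewrite ?d2 //=.
    by rewrite mdegMn mdeg1 mul1n -addn1 leq_add.
  by rewrite mulmnE mnm1E eqxx mul1n addn_gt0 X0.
by apply: (@flag_lift _ ord0 _ _ _ wt_zz); rewrite ?d2 ?dX ?tX.
Qed.

(** The functional on xz and y^2 kills J and the multiples of t; on p x it takes the coefficient of
    z in p. The monomials left outside (t,x,y) are powers of z from z^2 on, and z^2 is in the
    flag. *)
Lemma colon_x p : F 1 (p * 'X_x) -> F 3 p.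
Proof.
move=> Fp; have p0 : p@_0%MM = 0 := @mcoeff0_of_colon (@Ordinal 4 1 isT) p Fp.
have [/negbTE tx /negbTE ty /negbTE tz [/negbTE xy /negbTE xz /negbTE yz]] := idx_neq idx.
have pz : p@_U_(z) = 0.
  have : (p * 'X_x)@_(U_(x) + U_(z))%MM + (p * 'X_x)@_(U_(y) + U_(y))%MM = 0.
    apply: (flag_ind idJ (P := fun q => q@_(U_(x) + U_(z))%MM + q@_(U_(y) + U_(y))%MM = 0)) Fp.
    - exact: mcoeff_sum_2y.
    - by move=> q q' q0 q'0; rewrite !mcoeffD addrACA q0 q'0 addr0.
    move=> c i; rewrite ltnS leqn0 => /eqP i0.
    rewrite /lin_var i0 /= !mcoeffMXr.
    case: ifP => [/mnm_lepP/(_ t)|_]; first by rewrite mnmDE !mnm1E eqxx !(eq_sym _ t) tx tz.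
    case: ifP => [/mnm_lepP/(_ t)|_]; first by rewrite mnmDE !mnm1E eqxx !(eq_sym _ t) ty.
    by rewrite addr0.
  rewrite mcoeffMX mcoeffMXr; case: ifP => [/mnm_lepP/(_ x)|_]; last by rewrite addr0.
  by rewrite mnmDE !mnm1E eqxx (eq_sym y) xy.
rewrite (mpolyE p) big_seq; apply: (ideal_sum (idF 3)) => m.
rewrite mcoeff_msupp => pm; apply: (idealZ (idF 3)).
have [mt|mt] := posnP (m t); last by apply: (@flag_mon 3 ord0).
have [mx|mx] := posnP (m x); last by apply: (@flag_mon 3 (@Ordinal 4 1 isT)).
have [my|my] := posnP (m y); last by apply: (@flag_mon 3 (@Ordinal 4 2 isT)).
have [mz|mz] := leqP (m z) 1.
  exfalso; move: pm; rewrite -[_ != 0]/(~~ (_ == 0)) => /negP; apply; apply/eqP.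
  case mzE: (m z) mz => [|[|//]] _.
    by rewrite (_ : m = 0%MM) //; apply: (mnm4P idx); rewrite ?mt ?mx ?my ?mzE mnm0E.
  rewrite (_ : m = U_(z)%MM) //.
  by apply: (mnm4P idx); rewrite ?mt ?mx ?my ?mzE mnm1E ?(eq_sym z) ?tz ?xz ?yz ?eqxx.
have le_zz : (U_(z) + U_(z) <= m)%MM.
  apply/mnm_lepP => k; rewrite mnmDE !mnm1E; case: (eqVneq z k) => [<-|] //.
rewrite -(submK le_zz) mpolyXD; apply: (idealM (idF 3)).
have FX := @colon_ge (@Ordinal 4 3 isT) (@Ordinal 4 3 isT) isT.
by rewrite mpolyXD.
Qed.

Lemma flag0 p : F 0 p <-> J p.
Proof.
split=> [[c]|Jp]; first by rewrite big_pred0 ?subr0 // => i.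
exact: flagJ.
Qed.

Lemma colon_le (i : 'I_4) p : F i (p * lin_var i) -> F (colon_idx i) p.
Proof.
case: i => -[|[|[|[|//]]]] lt_i Fp /=.
- apply/flag0; apply: (IHstar_nonzerodivisor agt0 (t := t)); first exact: lifts_of_wt.
  exact/flag0.
- exact: colon_x.
- by apply/flag4P/(mcoeff0_of_colon Fp).
by apply/flag4P/(mcoeff0_of_colon Fp).
Qed.

Lemma koszul_mult5_labelled : koszul K a.
Proof.
apply: (koszul_of_flag idJ _ _ flag4P colon_le colon_ge) => [d p|i].
  exact: IHstar_homog.
by rewrite /homogeneous msuppX /= mdeg1.
Qed.
End MultiplicityFive.

Lemma koszul_of_mult5 (K : fieldType) (H : nat -> Prop) (a : 'I_4 -> nat) :
  min_gen_set H a -> symmetric_sg H -> multiplicity_is a 5 -> koszul K a.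
Proof.
move=> minG symH /(mult5_structure minG symH)[t [x [y [z [X [Y [[idx t5 [xE yE zE] X0 Y0] d]]]]]]].
exact: (koszul_mult5_labelled K minG symH idx t5 xE yE zE X0 Y0 d).
Qed.

Lemma koszul_quadratic (K : fieldType) (H : nat -> Prop) n (a : 'I_n -> nat) :
  min_gen_set H a -> koszul K a -> quadratic K a.
Proof.
move=> minG ka p; apply: koszul_ideal_quadratic => //.
- exact: IHstar_is_ideal.
- by move=> d q; apply: IHstar_homog.
- move=> q; apply: IHstar_lone_coef => m; rewrite wt0 => m0.
  apply/eqP; rewrite -mdeg_eq0 -leqn0.
  by apply: leq_trans (mdeg_le_wt m (gen_gt0 minG)) _; rewrite m0.
by move=> q i; apply: IHstar_lone_coef => m; rewrite wtU; apply: (gen_lone minG).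
Qed.

Theorem theorem3p12 (K : fieldType) (H : nat -> Prop) (a : 'I_4 -> nat) :
  numerical_semigroup H ->
  min_gen_set H a ->
  symmetric_sg H ->
  ~ complete_intersection K a ->
  [/\ (koszul K a <-> quadratic K a),
      (quadratic K a <-> multiplicity_is a 5),
      (multiplicity_is a 5 <-> exists x y, form_d H x y)
    & (forall x y x' y', form_d H x y -> form_d H x' y' -> x = x' /\ y = y')].
Proof.
move=> numH minG symH nCI.
have kq := koszul_quadratic (K := K) minG.
have q5 : quadratic K a -> multiplicity_is a 5.
  by move=> qa; apply: (quadratic_mult5 minG numH symH qa nCI).
have k5 := koszul_of_mult5 K minG symH.
split.
- by split=> [/kq|/q5/k5].
- by split=> [/q5|/k5/kq].
- split; first exact: mult5_form_d.
  by move=> [X [Y /(form_d_mult5 minG)]].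
by move=> X Y X' Y'; apply: (form_d_unique minG).
Qed.
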